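(* Let $\Lambda$ be a finite dimensional algebra over a field $k$ that is an $(n,p)$-eventually periodic $d$-Gorenstein algebra. Then $$d \leq n \leq d+1.$$ Moreover, there exists an isomorphism of $\Lambda^{\mathrm e}$-modules $$\Omega_{\Lambda^{\mathrm e}}^{d+p}(\Lambda) \oplus P \cong \Omega_{\Lambda^{\mathrm e}}^d(\Lambda)$$ for some finitely generated projective $\Lambda^{\mathrm e}$-module $P$. In particular, $n = d$ if and only if $\Omega_{\Lambda^{\mathrm e}}^d(\Lambda)$ has no non-zero projective direct summand.
   Context: Rings are associative and unital; modules are left modules. $\Lambda^{\mathrm e}=\Lambda\otimes_k\Lambda^{\mathrm{op}}$ is the enveloping algebra; $\Lambda^{\mathrm e}$-modules are identified with $\Lambda$-bimodules on which $k$ acts centrally. For a finite dimensional algebra $A$ and an $A$-module $M$, the syzygy $\Omega_A(M)$ is the kernel of a projective cover of $M$, $\Omega_A^0(M)=M$ and $\Omega_A^n(M)=\Omega_A(\Omega_A^{n-1}(M))$. $M$ is periodic if $\Omega_A^p(M)\cong M$ as $A$-modules for some $p>0$; the smallest such $p$ is its period. $M$ is $(n,p)$-eventually periodic if $n$ is the smallest non-negative integer such that $\Omega_A^n(M)$ is periodic, and $\Omega_A^n(M)$ has period $p$. The algebra $\Lambda$ is called $(n,p)$-eventually periodic if the regular bimodule $\Lambda$ is $(n,p)$-eventually periodic as a $\Lambda^{\mathrm e}$-module. $\Lambda$ is $d$-Gorenstein if it has finite injective dimension as a left and as a right module over itself, with $\operatorname{inj.dim}_\Lambda\Lambda=\operatorname{inj.dim}_{\Lambda^{\mathrm{op}}}\Lambda=d$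 (the two dimensions coincide when both are finite). *)

(* Defs.v *)
From HB Require Import structures.
From mathcomp Require Import all_boot all_algebra all_field.
From mathcomp Require Import boolp.

Set Implicit Arguments.
Unset Strict Implicit.
Unset Printing Implicit Defensive.

Import GRing.Theory.
Local Open Scope ring_scope.

Section Converse.
Variables (k : fieldType) (A : falgType k).

(* The opposite algebra is the converse ring A^c of MathComp, with the
   k-structure of A. *)
HB.instance Definition _ := GRing.Zmodule_isLmodule.Build k A^c
  (@scalerA k A) (@scale1r k A) (@scalerDr k A)
  (fun v a b => @scalerDl k A v a b).

Fact converse_scalerAl (c : k) (x y : A^c) : c *: (x * y) = (c *: x) * y.
Proof. exact: (@scalerAr k A). Qed.

Fact converse_scalerAr (c : k) (x y : A^c) : c *: (x * y) = x * (c *: y).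
Proof. exact: (@scalerAl k A). Qed.

HB.instance Definition _ :=
  GRing.Lmodule_isLalgebra.Build k A^c converse_scalerAl.
HB.instance Definition _ :=
  GRing.Lalgebra_isAlgebra.Build k A^c converse_scalerAr.

Import VectorInternalTheory.

Fact converse_vect_axiom : Vector.axiom (dim A) A^c.
Proof.
exists v2r; first by move=> a u v; apply: linearP.
exact: (Bijective (@v2rK _ A) (@r2vK _ A)).
Qed.

HB.instance Definition _ := Lmodule_hasFinDim.Build k A^c converse_vect_axiom.
End Converse.

Section Tensor.
Variables (k : fieldType) (A B : falgType k).

(* A tensor of A and B is stored as its family of B-coordinates x i along the
   chosen basis e of A, i.e. it stands for \sum_i e i ⊗ x i.  Independence of
   the basis is the universal property: [tlift_tens] and [tlift_is_linear]
   (existence), [tensor_ind] (uniqueness). *)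
Definition tensor : Type := {ffun 'I_(\dim {:A}) -> B}.

HB.instance Definition _ := Vector.on tensor.

Local Notation e i := ((vbasis {:A})`_i).

Definition tens (a : A) (b : B) : tensor :=
  [ffun i => coord (vbasis {:A}) i a *: b].

Local Notation "a ⊗ b" := (tens a b) (at level 40).

Lemma tens_is_linear_l (b : B) : linear (tens^~ b : A -> tensor).
Proof.
by move=> c a a'; apply/ffunP=> i; rewrite !ffunE linearP scalerDl scalerA.
Qed.

Lemma tens_is_linear_r (a : A) : linear (tens a : B -> tensor).
Proof.
move=> c b b'; apply/ffunP=> i; rewrite !ffunE scalerDr !scalerA.
by rewrite [c * _]mulrC.
Qed.

HB.instance Definition _ (a : A) :=
  GRing.isLinear.Build k B tensor *:%R (tens a) (tens_is_linear_r a).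

Definition tensr (b : B) (a : A) := tens a b.

HB.instance Definition _ (b : B) :=
  GRing.isLinear.Build k A tensor *:%R (tensr b) (tens_is_linear_l b).

Lemma tensZl c a b : (c *: a) ⊗ b = c *: (a ⊗ b).
Proof. exact: (linearZ_LR (tensr b)). Qed.

Lemma tensZr c a b : a ⊗ (c *: b) = c *: (a ⊗ b).
Proof. exact: (linearZ_LR (tens a)). Qed.

Lemma vbasis_decomp (a : A) :
  a = \sum_(i < \dim {:A}) coord (vbasis {:A}) i a *: e i.
Proof. exact: coord_vbasis (memvf a). Qed.

Lemma tensor_decomp (x : tensor) : x = \sum_(i < \dim {:A}) e i ⊗ x i.
Proof.
apply/ffunP=> j; rewrite sum_ffunE (bigD1 j) //= ffunE.
have fr := basis_free (vbasisP {:A}).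
rewrite coord_free // eqxx scale1r big1 ?addr0 // => i ij.
by rewrite ffunE coord_free // (negPf ij) scale0r.
Qed.

Lemma tensor_ind (P : tensor -> Prop) :
  P 0 -> (forall x y, P x -> P y -> P (x + y)) -> (forall a b, P (a ⊗ b)) ->
  forall x, P x.
Proof.
by move=> P0 PD Pt x; rewrite [x]tensor_decomp; apply: big_ind => // i _.
Qed.

Definition tlift (V : lmodType k) (beta : A -> B -> V) (x : tensor) : V :=
  \sum_(i < \dim {:A}) beta (e i) (x i).

Lemma tlift_tens (V : lmodType k) (beta : A -> B -> V) :
    (forall b, linear (beta^~ b)) -> (forall a, linear (beta a)) ->
  forall a b, tlift beta (a ⊗ b) = beta a b.
Proof.
move=> bl br a b; pose bl' := GRing.isLinear.Build k A V *:%R _ (bl b).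
pose F : {linear A -> V} := HB.pack (beta^~ b) bl'.
rewrite -[RHS]/(F a) [in RHS](vbasis_decomp a) linear_sum; apply: eq_bigr => i _.
rewrite ffunE linearZ /=; pose br' := GRing.isLinear.Build k B V *:%R _ (br (e i)).
pose G : {linear B -> V} := HB.pack (beta (e i)) br'.
by rewrite /= -[LHS]/(G _) linearZ.
Qed.

Lemma tlift_is_linear (V : lmodType k) (beta : A -> B -> V) :
  (forall a, linear (beta a)) -> linear (tlift beta).
Proof.
move=> br c x y; rewrite /tlift scaler_sumr -big_split; apply: eq_bigr => i _.
by rewrite !ffunE br.
Qed.

Definition tmul (x y : tensor) : tensor :=
  \sum_(i < \dim {:A}) \sum_(j < \dim {:A}) (e i * e j) ⊗ (x i * y j).

Lemma tmulDl : left_distributive tmul +%R.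
Proof.
move=> x y z; rewrite /tmul -big_split; apply: eq_bigr => i _.
rewrite -big_split; apply: eq_bigr => j _.
by rewrite !ffunE mulrDl linearD.
Qed.

Lemma tmulDr : right_distributive tmul +%R.
Proof.
move=> x y z; rewrite /tmul -big_split; apply: eq_bigr => i _.
rewrite -big_split; apply: eq_bigr => j _.
by rewrite !ffunE mulrDr linearD.
Qed.

Lemma tmul0l x : tmul 0 x = 0.
Proof. by apply: (addIr (tmul 0 x)); rewrite -tmulDl !add0r. Qed.

Lemma tmul0r x : tmul x 0 = 0.
Proof. by apply: (addIr (tmul x 0)); rewrite -tmulDr !add0r. Qed.

Lemma tmul_tens a b a' b' : tmul (a ⊗ b) (a' ⊗ b') = (a * a') ⊗ (b * b').
Proof.
rewrite /tmul [in RHS](vbasis_decomp a) [in RHS](vbasis_decomp a') mulr_suml.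
rewrite -[RHS]/(tensr _ _) linear_sum; apply: eq_bigr => i _.
rewrite mulr_sumr linear_sum; apply: eq_bigr => j _ /=.
rewrite !ffunE -!scalerAl -!scalerAr.
by rewrite /tensr !tensZl !tensZr.
Qed.

Lemma tmulA : associative tmul.
Proof.
move=> x y z; elim/tensor_ind: x => [|x x' Hx Hx'|a b]; first by rewrite !tmul0l.
  by rewrite !tmulDl Hx Hx'.
elim/tensor_ind: y => [|y y' Hy Hy'|a' b']; first by rewrite !(tmul0l, tmul0r).
  by rewrite !(tmulDl, tmulDr) Hy Hy'.
elim/tensor_ind: z => [|z z' Hz Hz'|a'' b'']; first by rewrite !tmul0r.
  by rewrite !tmulDr Hz Hz'.
by rewrite !tmul_tens !mulrA.
Qed.

Lemma tmul1l : left_id (1 ⊗ 1) tmul.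
Proof.
move=> x; elim/tensor_ind: x => [|x x' Hx Hx'|a b]; first by rewrite !tmul0r.
  by rewrite !tmulDr Hx Hx'.
by rewrite tmul_tens !mul1r.
Qed.

Lemma tmul1r : right_id (1 ⊗ 1) tmul.
Proof.
move=> x; elim/tensor_ind: x => [|x x' Hx Hx'|a b]; first by rewrite !tmul0l.
  by rewrite !tmulDl Hx Hx'.
by rewrite tmul_tens !mulr1.
Qed.

Lemma tone_neq0 : 1 ⊗ 1 != 0.
Proof.
apply/eqP=> /ffunP t0; have := oner_neq0 A.
rewrite [X in X != _]vbasis_decomp big1 ?eqxx // => i _.
have := t0 i; rewrite !ffunE => /eqP; rewrite scaler_eq0 oner_eq0 orbF.
by move=> /eqP->; rewrite scale0r.
Qed.

HB.instance Definition _ := GRing.Zmodule_isNzRing.Build tensor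
  tmulA tmul1l tmul1r tmulDl tmulDr tone_neq0.

Lemma tensM a b a' b' : (a ⊗ b) * (a' ⊗ b') = (a * a') ⊗ (b * b').
Proof. exact: tmul_tens. Qed.

Lemma tens11 : 1 ⊗ 1 = 1. Proof. by []. Qed.

Fact tensor_scalerAl (c : k) (x y : tensor) : c *: (x * y) = (c *: x) * y.
Proof.
rewrite [LHS]scaler_sumr; apply: eq_bigr => i _.
rewrite scaler_sumr; apply: eq_bigr => j _.
by rewrite !ffunE -linearZ /= scalerAl.
Qed.

Fact tensor_scalerAr (c : k) (x y : tensor) : c *: (x * y) = x * (c *: y).
Proof.
rewrite [LHS]scaler_sumr; apply: eq_bigr => i _.
rewrite scaler_sumr; apply: eq_bigr => j _.
by rewrite !ffunE -linearZ /= scalerAr.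
Qed.

HB.instance Definition _ :=
  GRing.Lmodule_isLalgebra.Build k tensor tensor_scalerAl.
HB.instance Definition _ :=
  GRing.Lalgebra_isAlgebra.Build k tensor tensor_scalerAr.
HB.instance Definition _ := Algebra_isFalgebra.Build k tensor.
End Tensor.

Section Enveloping.
Variables (k : fieldType) (A : falgType k).

Definition enveloping := tensor A A^c.
HB.instance Definition _ := Falgebra.on enveloping.

(* A as a left module over its enveloping algebra: (a ⊗ b) *: x = a * x * b,
   see [env_act_tens]. *)
Definition bimodule : Type := A.
HB.instance Definition _ := GRing.Zmodule.on bimodule.

Definition env_act (t : enveloping) (x : bimodule) : bimodule :=
  tlift (fun (a : A) (b : A^c) => a * (x : A) * (b : A)) t.

Let bl (x : bimodule) (b : A^c) : linear (fun a : A => a * (x : A) * (b : A)).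
Proof. by move=> c a a' /=; rewrite !mulrDl !scalerAl. Qed.

Let br (x : bimodule) (a : A) : linear (fun b : A^c => a * (x : A) * (b : A)).
Proof. by move=> c b b' /=; rewrite mulrDr -[in LHS]scalerAr. Qed.

Lemma env_act_tens (a : A) (b : A^c) (x : A) : env_act (tens a b) x = a * x * (b : A).
Proof. exact: tlift_tens (bl x) (br x) a b. Qed.

Fact env_actDl x : {morph env_act^~ x : t u / t + u}.
Proof.
move=> t u; have /(_ 1 t u) := tlift_is_linear (br x).
by rewrite !scale1r.
Qed.

Fact env_actDr : right_distributive env_act +%R.
Proof.
move=> t x y; rewrite /env_act /tlift -[RHS]big_split; apply: eq_bigr => i _.
by rewrite /= mulrDr mulrDl.
Qed.

Fact env_act1 : left_id 1 env_act.
Proof. by move=> x; rewrite -tens11 env_act_tens mul1r mulr1. Qed.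

Fact env_act0 x : env_act 0 x = 0.
Proof. by apply: (addIr (env_act 0 x)); rewrite -env_actDl !add0r. Qed.

Fact env_act0r t : env_act t 0 = 0.
Proof. by apply: (addIr (env_act t 0)); rewrite -env_actDr !add0r. Qed.

Fact env_actA t u x : env_act t (env_act u x) = env_act (t * u) x.
Proof.
elim/tensor_ind: t => [|t t' Ht Ht'|a b]; first by rewrite mul0r !env_act0.
  by rewrite mulrDl !env_actDl Ht Ht'.
elim/tensor_ind: u => [|u u' Hu Hu'|a' b'].
- by rewrite mulr0 !env_act0 env_act0r.
- by rewrite mulrDr !env_actDl env_actDr Hu Hu'.
by rewrite tensM !env_act_tens !mulrA.
Qed.

HB.instance Definition _ := GRing.Zmodule_isLmodule.Build enveloping bimodule
  env_actA env_act1 env_actDr env_actDl.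

Lemma bimodule_scaleE (a b x : A) :
  (tens a (b : A^c) : enveloping) *: (x : bimodule) = a * x * b.
Proof. exact: env_act_tens. Qed.
End Enveloping.

Section Modules.
Variable R : pzRingType.
Implicit Types M N P : lmodType R.

Definition onto (T U : Type) (f : T -> U) : Prop := forall y, exists x, f x = y.

Definition module_iso M N : Prop := exists f : {linear M -> N}, bijective f.

Definition fin_gen M : Prop := exists m (s : 'I_m -> M),
  forall x, exists c : 'I_m -> R, x = \sum_(i < m) c i *: s i.

Definition projective P : Prop :=
  forall (X Y : lmodType R) (f : {linear X -> Y}) (g : {linear P -> Y}),
    onto f -> exists h : {linear P -> X}, forall x, f (h x) = g x.

Definition injective_module (I : lmodType R) : Prop :=
  forall (X Y : lmodType R) (f : {linear X -> Y}) (g : {linear X -> I}),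
    injective f -> exists h : {linear Y -> I}, forall x, h (f x) = g x.

Definition essential_epi M N (f : {linear M -> N}) : Prop :=
  onto f /\
  forall (X : lmodType R) (g : {linear X -> M}), onto (f \o g) -> onto g.

Definition projective_cover P M (f : {linear P -> M}) : Prop :=
  projective P /\ essential_epi f.

Definition injective_resolution M
    (I : nat -> lmodType R) (e : {linear M -> I 0})
    (d : forall i, {linear I i -> I i.+1}) : Prop :=
  [/\ forall i, injective_module (I i),
      injective e,
      forall x, d 0 x = 0 <-> exists y, e y = x &
      forall i x, d i.+1 x = 0 <-> exists y, d i y = x].

(* An injective resolution of length at most n is one that vanishes in
   degrees > n. *)
Definition inj_dim_le M (n : nat) : Prop :=
  exists (I : nat -> lmodType R) (e : {linear M -> I 0})
         (d : forall i, {linear I i -> I i.+1}),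
    injective_resolution e d /\ forall i, (n < i)%N -> forall x : I i, x = 0.

Definition inj_dim M (n : nat) : Prop :=
  inj_dim_le M n /\ forall m, inj_dim_le M m -> (n <= m)%N.

Definition projective_summand P M : Prop :=
  projective P /\ exists X : lmodType R, module_iso (X * P)%type M.

End Modules.

Section Kernel.
Variables (R : pzRingType) (M N : lmodType R) (f : {linear M -> N}).

Definition in_ker : {pred M} := [pred x | f x == 0].

Fact in_ker_closed : submod_closed in_ker.
Proof.
split=> [|a x y]; rewrite !inE ?linear0 // linearP.
by move=> /eqP-> /eqP->; rewrite scaler0 addr0.
Qed.

HB.instance Definition _ := GRing.isSubmodClosed.Build R M in_ker in_ker_closed.

Inductive ker_module : predArgType := KerModule x of x \in in_ker.

Definition ker_val (u : ker_module) : M := let: KerModule x _ := u in x.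

HB.instance Definition _ := [isSub for ker_val].
HB.instance Definition _ := [Choice of ker_module by <:].
HB.instance Definition _ := [SubChoice_isSubLmodule of ker_module by <:].
End Kernel.

Section Syzygies.
Variable R : pzRingType.
Implicit Types M N P : lmodType R.

Record module_over M := ModuleOver {
  over_module : lmodType R;
  over_map : {linear over_module -> M} }.

(* The identity branch is junk: over a finite dimensional algebra every
   finitely generated module has a projective cover ([chosen_coverP]) and its
   syzygies stay finitely generated ([syz_fin_gen]).  The choice of the cover
   does not matter up to isomorphism ([syzygyP]). *)
Definition chosen_cover M : module_over M :=
  if pselect (exists c : module_over M, projective_cover (over_map c))
    is left h then sval (cid h) else ModuleOver (idfun : {linear M -> M}).

Definition syzygy M : lmodType R := ker_module (over_map (chosen_cover M)).

Definition syz n M := iter n syzygy M.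

Definition periodic M := exists2 p, (0 < p)%N & module_iso (syz p M) M.

Definition has_period p M := [/\ (0 < p)%N, module_iso (syz p M) M &
  forall q, (0 < q)%N -> module_iso (syz q M) M -> (p <= q)%N].

Definition eventually_periodic n p M :=
  has_period p (syz n M) /\ forall m, periodic (syz m M) -> (n <= m)%N.
End Syzygies.

Section Covers.
Variables (k : fieldType) (A : falgType k).
Implicit Types M N P Q : lmodType A.

Definition kcomb (M : lmodType A) n (s : 'I_n -> M) (v : 'rV[k]_n) : M :=
  \sum_(i < n) (v 0 i)%:A *: s i.

Definition kspan M n := exists s : 'I_n -> M, onto (kcomb s).

Lemma kcomb_is_additive M n (s : 'I_n -> M) (c : k) v w :
  kcomb s (c *: v + w) = c%:A *: kcomb s v + kcomb s w.
Proof.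
rewrite /kcomb scaler_sumr -big_split; apply: eq_bigr => i _ /=.
by rewrite !mxE scalerDl scalerA -scalerAl mul1r scalerDl scalerA.
Qed.

Lemma scalar_comm (c : k) (a : A) : c%:A * a = a * c%:A.
Proof. by rewrite -scalerAl -scalerAr mul1r mulr1. Qed.

Lemma fin_gen_kspan M : fin_gen M -> exists n, kspan M n.
Proof.
case=> m [s sP]; pose d := \dim {:A}.
pose t (p : 'I_m * 'I_d) : M := (vbasis {:A})`_p.2 *: s p.1.
exists #|{: 'I_m * 'I_d}|, (fun i => t (enum_val i)) => x.
have [c ->] := sP x.
exists (\row_i coord (vbasis {:A}) (enum_val i).2 (c (enum_val i).1)).
rewrite /kcomb; under eq_bigr do rewrite mxE.
pose F (p : 'I_m * 'I_d) := (coord (vbasis {:A}) p.2 (c p.1))%:A *: t p.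
rewrite -(reindex (@enum_val _ _) (F := F) (P := xpredT)) /=; last first.
  by apply: onW_bij; apply: enum_val_bij.
rewrite -(pair_big xpredT xpredT (fun i j => F (i, j))) /=.
apply: eq_bigr => i _; rewrite [in RHS](vbasis_decomp (c i)) scaler_suml.
by apply: eq_bigr => j _; rewrite /F /t scalerA -scalerAl mul1r.
Qed.

Lemma kspan_fin_gen M n : kspan M n -> fin_gen M.
Proof.
case=> s sP; exists n, s => x; have [v <-] := sP x.
by exists (fun i => (v 0 i)%:A).
Qed.

Definition freemod m := {ffun 'I_m -> A^o}.

Definition freemod_map M m (y : 'I_m -> M) (x : freemod m) : M :=
  \sum_(i < m) (x i : A) *: y i.

Fact freemod_map_linear M m (y : 'I_m -> M) : linear (freemod_map y).
Proof.
move=> a u v; rewrite /freemod_map scaler_sumr -big_split.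
by apply: eq_bigr => i _ /=; rewrite !ffunE scalerDl scalerA.
Qed.

HB.instance Definition _ M m (y : 'I_m -> M) :=
  GRing.isLinear.Build A (freemod m) M *:%R (freemod_map y)
    (freemod_map_linear y).

Definition freemod_gen m (i : 'I_m) : freemod m := [ffun j => (i == j)%:R].

Lemma freemod_decomp m (x : freemod m) :
  x = \sum_(i < m) (x i : A) *: freemod_gen i.
Proof.
apply/ffunP=> j; rewrite sum_ffunE (bigD1 j) //= !ffunE eqxx.
rewrite big1 ?addr0 => [|i ij]; first by rewrite [_ *: _]mulr1.
by rewrite !ffunE (negPf ij) scaler0.
Qed.

Lemma freemod_fin_gen m : fin_gen (freemod m).
Proof. by exists m, (@freemod_gen m) => x; exists x; apply: freemod_decomp. Qed.

Lemma freemod_projective m : projective (freemod m).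
Proof.
move=> X Y f g fS.
have /choice[y fy] : forall i, exists y, f y = g (freemod_gen i).
  by move=> i; apply: fS.
exists (freemod_map y) => x; rewrite [in RHS](freemod_decomp x) !linear_sum.
by apply: eq_bigr => i _; rewrite !linearZ fy.
Qed.

Section Idempotent.
Variables (M P : lmodType A) (f : {linear P -> M}) (e : {linear P -> P}) (n : nat).
Variables (s : 'I_n.+1 -> P) (sS : onto (kcomb s)).
Hypothesis fe : forall x, f (e x) = f x.
Hypothesis eN : ~ onto e.

Definition poly_end (p : {poly k}) (x : P) : P :=
  \sum_(j < size p) (p`_j)%:A *: iter j e x.

Fact iter_linear j : linear (iter j e).
Proof. by elim: j => //= j IH a x y; have /= -> := IH a x y; rewrite linearP. Qed.

Fact pe_linear p : linear (poly_end p).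
Proof.
move=> a x y; rewrite /poly_end scaler_sumr -big_split; apply: eq_bigr => j _ /=.
by rewrite iter_linear scalerDr !scalerA scalar_comm.
Qed.

Lemma f_pe p x : f (poly_end p x) = p.[1]%:A *: f x.
Proof.
rewrite linear_sum horner_coef scaler_suml scaler_suml; apply: eq_bigr => j _.
rewrite linearZ expr1n mulr1 /=; congr (_ *: _).
by elim: (nat_of_ord j) => //= i <-; rewrite fe.
Qed.

Lemma exists_matrix : exists E : 'M[k]_n.+1,
  forall v, e (kcomb s v) = kcomb s (v *m E).
Proof.
have /choice[r rP] : forall i, exists r, kcomb s r = e (s i).
  by move=> i; apply: sS.
exists (\matrix_(i, j) r i 0 j) => v.
rewrite linear_sum /kcomb.
under eq_bigr do rewrite linearZ -rP /= /kcomb scaler_sumr.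
rewrite exchange_big; apply: eq_bigr => j _ /=.
rewrite mxE scaler_suml scaler_suml; apply: eq_bigr => i _.
by rewrite mxE scalerA -scalerAl mul1r scalerA.
Qed.

Lemma exists_idempotent : exists eps : {linear P -> P},
  [/\ forall x, eps (eps x) = eps x, forall x, f (eps x) = f x & ~ onto eps].
Proof.
have [E EP] := exists_matrix.
have peE p v : poly_end p (kcomb s v) = kcomb s (v *m horner_mx E p).
  have itE j : iter j e (kcomb s v) = kcomb s (v *m E ^+ j).
    elim: j => [|j IH]; first by rewrite mulmx1.
    by rewrite /= IH EP exprSr mulmxA.
  have -> : horner_mx E p = \sum_(j < size p) p`_j *: E ^+ j.
    rewrite -[in LHS](coefK p) poly_def rmorph_sum; apply: eq_bigr => j _.
    by rewrite /= horner_mxZ rmorphXn /= horner_mx_X.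
  rewrite mulmx_sumr; under [LHS]eq_bigr do rewrite itE.
  have kc0 : kcomb s 0 = 0.
    by rewrite /kcomb big1 // => i _; rewrite mxE !scale0r.
  elim/big_rec2: _ => [|j y1 y2 _ ->]; first by rewrite kc0.
  by rewrite -kcomb_is_additive scalemxAr.
have peM p q x : poly_end (p * q) x = poly_end q (poly_end p x).
  by have [v <-] := sS x; rewrite !peE rmorphM mulmxA.
have pe0 p x : char_poly E %| p -> poly_end p x = 0.
  case/Pdiv.Field.dvdpP => q ->; have [v <-] := sS x.
  rewrite peE rmorphM /= Cayley_Hamilton mulr0 mulmx0 /kcomb big1 // => i _.
  by rewrite mxE !scale0r.
have peD p q x : poly_end (p + q) x = poly_end p x + poly_end q x.
  have [v <-] := sS x; rewrite !peE rmorphD mulmxDr.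
  by rewrite -[X in kcomb s (X + _)]scale1r kcomb_is_additive !scale1r.
have [m [q q0 chE]] := multiplicity_XsubC (char_poly E) 0.
have {}q0 : ~~ root q 0.
  by apply: (implyP q0); apply: monic_neq0; apply: char_poly_monic.
rewrite subr0 in chE.
have : coprimep q ('X^(m.+1)).
  by apply: coprimep_expr; rewrite -['X]subr0 coprimep_XsubC.
case/Bezout_eq1_coprimepP => -[u v] /= uv1.
have qX : char_poly E %| q * 'X^(m.+1).
  by rewrite chE exprSr mulrA dvdp_mulr.
pose p := v * 'X^(m.+1).
have pp : p = p * p + u * v * (q * 'X^(m.+1)).
  rewrite -[LHS]mulr1 -uv1 mulrDr addrC; congr (_ + _).
  by rewrite /p mulrACA (mulrC v) [X in _ * X]mulrC.
have ppI x : poly_end p (poly_end p x) = poly_end p x.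
  by rewrite [in RHS]pp peD peM [X in _ + X]pe0 ?addr0 // dvdp_mull.
have fp x : f (poly_end p x) = f x.
  have q1f : q.[1]%:A *: f x = 0.
    have := f_pe (q * 'X^(m.+1)) x; rewrite pe0 // linear0 => /esym.
    by rewrite hornerM hornerXn expr1n mulr1.
  have := congr1 (fun r : {poly k} => r.[1]) uv1.
  rewrite !(hornerE, hornerXn) expr1n mulr1 => uv1'.
  rewrite f_pe /p hornerM hornerXn expr1n mulr1.
  have -> : v.[1] = 1 - u.[1] * q.[1] by move/eqP: uv1'; rewrite addrC eq_sym -subr_eq => /eqP ->.
  rewrite !(scalerBl, scale1r).
  have -> : (u.[1] * q.[1])%:A = u.[1]%:A * q.[1]%:A :> A.
    by rewrite -scalerAl mul1r scalerA.
  by rewrite -scalerA q1f scaler0 subr0.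
pose peL := GRing.isLinear.Build A P P *:%R _ (pe_linear p).
pose eps : {linear P -> P} := HB.pack (poly_end p) peL.
exists eps; split=> // epsS; apply: eN => y; have [x <-] := epsS y.
rewrite /= /p exprSr mulrA peM; set z := poly_end _ x.
by have [w <-] := sS z; exists (kcomb s w); rewrite peE horner_mx_X EP.
Qed.

Lemma smaller_cover : exists (P' : lmodType A) (f' : {linear P' -> M}),
  [/\ projective P -> projective P', onto f -> onto f' & kspan P' n].
Proof.
have [eps [epsI feps epsN]] := exists_idempotent.
pose delta x := x - eps x.
have dl : linear delta.
  by move=> a x y; rewrite /delta linearP scalerBr opprD addrACA.
pose D : {linear P -> P} := HB.pack delta (GRing.isLinear.Build A P P *:%R _ dl).
pose P' : lmodType A := ker_module D.
have rin x : eps x \in in_ker D by rewrite inE /= /delta epsI subrr.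
pose rho x : P' := KerModule (rin x).
have rl : linear rho by move=> a x y; apply: val_inj; rewrite /= linearP.
pose Rho : {linear P -> P'} := HB.pack rho (GRing.isLinear.Build A P P' *:%R _ rl).
have epsV (u : P') : eps (val u) = val u.
  by have := valP u; rewrite inE /= /delta subr_eq0 => /eqP.
have rhoV (u : P') : rho (val u) = u by apply: val_inj; rewrite /= epsV.
pose V : {linear P' -> P} := val : {linear P' -> P}.
exists P', (f \o V); split.
- move=> Pp X Y h g hS; have [l lP] := Pp X Y h (g \o Rho) hS.
  by exists (l \o V) => u; rewrite /= lP /= rhoV.
- by move=> fS y; have [x <-] := fS y; exists (rho x); rewrite /= feps.
have [y yN] : exists y, ~ exists x, eps x = y by apply/existsNP.
have [c cP] := sS (y - eps y).
have ec0 : eps (kcomb s c) = 0 by rewrite cP linearB epsI subrr.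
have [i0 ci0] : exists i, c 0 i != 0.
  apply/not_existsP => c0; apply: yN; exists y; apply/esym/eqP.
  rewrite -subr_eq0 -cP /kcomb big1 // => i _.
  by have /negP/negPn/eqP-> := c0 i; rewrite !scale0r.
exists (fun j => rho (s (lift i0 j))) => u.
have [v vP] := sS (val u).
pose w := - (v 0 i0 / c 0 i0) *: c + v.
have w0 : w 0 i0 = 0 by rewrite !mxE mulNr divfK // addNr.
exists (\row_j w 0 (lift i0 j)); apply: val_inj.
rewrite -[RHS]epsV -vP.
transitivity (eps (kcomb s w)); last first.
  by rewrite kcomb_is_additive linearP ec0 scaler0 add0r.
rewrite /kcomb [in RHS](bigD1 i0) //= w0 !scale0r add0r.
rewrite [LHS](linear_sum V) linear_sum.
rewrite [RHS](reindex_omap (lift i0) (unlift i0)) /=; last first.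
  by move=> i; case: unliftP => [j ->|->] //=; rewrite eqxx.
apply: eq_big => [j|j _]; first by rewrite eq_sym neq_lift liftK eqxx.
by rewrite !linearZ /= mxE.
Qed.
End Idempotent.

Lemma surj_cover n P M (f : {linear P -> M}) : projective P -> onto f ->
  kspan P n -> exists c : module_over M, projective_cover (over_map c).
Proof.
elim: n P f => [|n IH] P f Pp fS [s sS].
  exists (ModuleOver f); split=> //; split=> // X g _ y; exists 0.
  by have [v <-] := sS y; rewrite linear0 /kcomb big_ord0.
have [|/not_andP[]//] := pselect (essential_epi f).
  by exists (ModuleOver f).
move=> /existsNP[X] /existsNP[g] /not_implyP[fgS gN].
have [h hP] := Pp X M (f \o g) f fgS.
have eN : ~ onto (g \o h).
  by move=> eS; apply: gN => y; have [x <-] := eS y; exists (h x).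
have [P' [f' [P'p f'S P's]]] := smaller_cover (e := g \o h) sS hP eN.
by apply: (IH P' f') => //; [apply: P'p | apply: f'S].
Qed.

Lemma projective_cover_exists M :
  fin_gen M -> exists c : module_over M, projective_cover (over_map c).
Proof.
case=> m [y yP]; have [n Fn] := fin_gen_kspan (freemod_fin_gen m).
apply: (@surj_cover n (freemod m) M (freemod_map y)) => //.
  exact: freemod_projective.
by move=> x; have [c ->] := yP x; exists [ffun i => c i];
  apply: eq_bigr => i _; rewrite ffunE.
Qed.

Lemma chosen_coverP M :
  fin_gen M -> projective_cover (over_map (chosen_cover M)).
Proof.
move=> /projective_cover_exists cM; rewrite /chosen_cover.
by case: pselect => // h; case: cid.
Qed.

Lemma cover_fin_gen P M (f : {linear P -> M}) :
  essential_epi f -> fin_gen M -> fin_gen P.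
Proof.
move=> [fS fE] [m [y yP]].
have /choice[x xP] : forall i, exists x, f x = y i by move=> i; apply: fS.
have gS : onto (freemod_map x).
  apply: fE => z; have [c ->] := yP z; exists [ffun i => c i].
  rewrite /= linear_sum; apply: eq_bigr => i _.
  by rewrite linearZ /= xP ffunE.
by exists m, x => z; have [c <-] := gS z; exists c.
Qed.

Lemma subspace_gen n (S : 'rV[k]_n -> Prop) : exists m (G : 'M[k]_(m, n)),
  (forall i, S (row i G)) /\ forall v, S v -> (v <= G)%MS.
Proof.
suff H r m (G : 'M[k]_(m, n)) : (forall i, S (row i G)) ->
    (n - \rank G < r)%N -> exists m (G : 'M[k]_(m, n)),
    (forall i, S (row i G)) /\ forall v, S v -> (v <= G)%MS.
  by apply: (H n.+1 0%N (0 : 'M_(0, n))) => [[]//|]; rewrite ltnS leq_subr.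
elim: r m G => // r IH m G SG rG.
have [|/existsNP[v /not_implyP[Sv vG]]] :=
  pselect (forall v, S v -> (v <= G)%MS); first by exists m, G.
have rlt : (\rank G < \rank (col_mx G v))%N.
  rewrite -addsmxE; apply: rank_ltmx; rewrite ltmxE addsmxSl addsmx_sub.
  by rewrite submx_refl; apply/negP.
apply: (IH _ (col_mx G v)) => [i|].
  case: (split_ordP i) => j ->; first by rewrite rowKu.
  by rewrite rowKd row_id.
rewrite -ltnS; apply: leq_trans rG; rewrite ltnS; apply: ltn_sub2l => //.
exact: leq_trans rlt (rank_leq_col _).
Qed.

Lemma ker_fin_gen P M (f : {linear P -> M}) :
  fin_gen P -> fin_gen (ker_module f).
Proof.
move=> /fin_gen_kspan[n [s sS]].
have [m [G [SG GP]]] := subspace_gen (fun v => f (kcomb s v) = 0).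
have Gin i : kcomb s (row i G) \in in_ker f by rewrite inE SG.
apply: (@kspan_fin_gen _ m); exists (fun i => KerModule (Gin i)) => u.
have [v vu] := sS (val u).
have /submxP[w vw] : (v <= G)%MS.
  by apply: GP; rewrite vu; apply/eqP; apply: (valP u).
pose V : {linear ker_module f -> P} := val : {linear ker_module f -> P}.
exists w; apply: val_inj; rewrite -vu vw [LHS](linear_sum V).
rewrite /kcomb.
under eq_bigr do rewrite linearZ /= /kcomb scaler_sumr.
rewrite exchange_big; apply: eq_bigr => j _ /=; rewrite mxE !scaler_suml.
by apply: eq_bigr => i _; rewrite mxE scalerA -scalerAl mul1r scalerA.
Qed.

Lemma syz_fin_gen n M : fin_gen M -> fin_gen (syz n M).
Proof.
rewrite /syz => Mf; elim: n => [|n IH] /=; first exact: Mf.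
apply: ker_fin_gen.
by have [_ essf] := chosen_coverP IH; apply: cover_fin_gen essf IH.
Qed.

Lemma ker_cover_unique P Q M (f : {linear P -> M}) (g : {linear Q -> M}) :
  projective_cover f -> projective_cover g ->
  module_iso (ker_module f) (ker_module g).
Proof.
move=> [Pp [fS fE]] [Qp [gS gE]].
have [h hP] := Pp Q M g f gS.
have hS : onto h.
  by apply: gE => y; have [x <-] := fS y; exists x; rewrite /= hP.
have [t tP] := Qp P Q h idfun hS.
have ft y : f (t y) = g y by rewrite -hP tP.
have tS : onto t.
  by apply: fE => y; have [x <-] := gS y; exists x; rewrite /= ft.
have th x : t (h x) = x by have [y <-] := tS x; rewrite tP.
have hin (u : ker_module f) : h (val u) \in in_ker g.
  by have := valP u; rewrite !inE hP.
have tin (u : ker_module g) : t (val u) \in in_ker f.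
  by have := valP u; rewrite !inE ft.
pose H u := KerModule (hin u).
have Hl : linear H by move=> a x y; apply: val_inj; rewrite /= linearP.
pose HL : {linear ker_module f -> ker_module g} :=
  HB.pack H (GRing.isLinear.Build A _ _ *:%R _ Hl).
exists HL; exists (fun u => KerModule (tin u)) => u; apply: val_inj.
  by rewrite /= th.
by rewrite /= tP.
Qed.

Lemma syzygyP P M (f : {linear P -> M}) :
  fin_gen M -> projective_cover f -> module_iso (ker_module f) (syzygy M).
Proof. by move=> /chosen_coverP cM fC; apply: ker_cover_unique. Qed.
End Covers.

Lemma bimodule_fin_gen (k : fieldType) (A : falgType k) :
  fin_gen (bimodule A).
Proof.
exists 1%N, (fun=> (1 : A)) => x; exists (fun=> tens (x : A) (1 : A^c)).
by rewrite big_ord1 bimodule_scaleE !mulr1.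
Qed.

Definition eventually_periodic_algebra (k : fieldType) (A : falgType k)
    (n p : nat) : Prop :=
  eventually_periodic (R := enveloping A) n p (bimodule A).

(* Right A-modules are left modules over A^c. *)
Definition gorenstein (k : fieldType) (A : falgType k) (d : nat) : Prop :=
  inj_dim (A^o : lmodType A) d /\ inj_dim ((A^c)^o : lmodType A^c) d.

(* Main.v *)
Require Import Defs.
From HB Require Import structures.
From mathcomp Require Import all_boot all_algebra all_field.
From mathcomp Require Import ring.
From mathcomp Require Import boolp classical_sets functions.

Set Implicit Arguments.
Unset Strict Implicit.
Unset Printing Implicit Defensive.

Import GRing.Theory.
Local Open Scope ring_scope.

(** Write E for the enveloping algebra of L, X_i for the i-th syzygy of the
    bimodule L, P_i for the projective cover of X_i, and, for a bimodule X,
    X^* for the left L-module Hom_L(X, L) of left linear maps to L, on which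
    L acts through the right action on X ([left_dual]).

    The proof rests on the behaviour of the modules X_i^*.  Every X_i is
    projective as a left L-module, so the exact sequences
    0 -> X_(i+1) -> P_i -> X_i -> 0 split on the left and dualize to exact
    sequences 0 -> X_i^* -> P_i^* -> X_(i+1)^* -> 0.  Here P_i^* is injective:
    it is a direct summand of a power of E^* = Hom_k(L, L), which is coinduced
    from k ([left_dual_projective_injective]).  As X_0^* is L itself, the
    X_i^* are the cosyzygies of an injective resolution of L, whence
    inj.dim L <= i if and only if X_i^* is injective
    ([inj_dim_syz_left_dual]).

    - d <= n: since X_n is isomorphic to X_(n + m p) for all m and X_i^* is
      injective for i >= d, the module X_n^* is injective, so
      d = inj.dim L <= n.

    - For i >= d the injectivity of X_i^* splits the dual sequence above, and a
      left L-linear splitting of P_i^* -> X_(i+1)^* turns into an extension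
      of bimodule maps: every map from X_(i+1) to a finitely generated
      projective E-module extends to P_i ([kernel_extension_projective]); that
      is, Ext^1_E(X_i, E) = 0.  Consequently X_j has no non-zero projective
      summand when j > d ([syz_projective_free]).

    - Suppose that i >= d, j > d and X_(i+1) is isomorphic to X_(j+1).  Both
      the isomorphism and its inverse extend to maps F : P_i -> P_j and
      G : P_j -> P_i.  The composite F G is the identity on X_(j+1); by the
      Fitting lemma its nilpotent part is then a projective summand of X_j,
      hence zero, and F G is invertible.  So X_i is the direct sum of X_j and
      the projective module ker F ([iso_of_kernels]).

    Starting from X_n = X_(n + p) and descending one syzygy at a time, the last
    item gives X_i = X_(i + p) for all i > d, because then the projective
    complement must vanish, and one more step gives
    X_d = X_(d + p) + projective.  The bound n <= d + 1 and the criterion for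
    n = d follow. *)

(** * Linear maps and direct summands *)

Section LinearMaps.
Variable R : pzRingType.
Implicit Types M N P X Y : lmodType R.

Lemma linear_map M N (f : M -> N) :
  linear f -> exists g : {linear M -> N}, forall x, g x = f x.
Proof.
move=> fl; pose g : {linear M -> N} := HB.pack f (GRing.isLinear.Build R M N *:%R f fl).
by exists g.
Qed.

Lemma linear_bijective M N (f : {linear M -> N}) :
  (forall x, f x = 0 -> x = 0) -> onto f -> bijective f.
Proof.
move=> fI /choice[g fg]; exists g => x; last exact: fg.
by apply/eqP; rewrite -subr_eq0; apply/eqP/fI; rewrite linearB fg subrr.
Qed.

Lemma linear_inverse M N (f : {linear M -> N}) : bijective f ->
  exists g : {linear N -> M}, cancel f g /\ cancel g f.
Proof.
case=> g fK gK; have gl : linear g.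
  by move=> a x y; apply: (can_inj fK); rewrite linearP !gK.
have [h hg] := linear_map gl.
by exists h; split=> x; rewrite hg.
Qed.

Lemma module_iso_refl M : module_iso M M.
Proof. by exists idfun; exists id. Qed.

Lemma module_iso_sym M N : module_iso M N -> module_iso N M.
Proof. by move=> [f /linear_inverse[g [fK gK]]]; exists g; exists f. Qed.

Lemma module_iso_trans N M P : module_iso M N -> module_iso N P -> module_iso M P.
Proof. by move=> [f fb] [g gb]; exists (g \o f); apply: bij_comp. Qed.

Lemma linear_factor X Y P (q : {linear P -> X}) (g : {linear P -> Y}) : onto q ->
  (forall x, q x = 0 -> g x = 0) ->
  exists h : {linear X -> Y}, forall x, h (q x) = g x.
Proof.
move=> qS qg; have /choice[s sP] := qS.
have gE x y : q x = q y -> g x = g y.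
  by move=> xy; apply/eqP; rewrite -subr_eq0 -linearB qg // linearB xy subrr.
have hl : linear (fun x => g (s x)).
  by move=> a x y; rewrite -linearP; apply: gE; rewrite linearP !sP.
have [h hE] := linear_map hl.
by exists h => x; rewrite hE; apply: gE; rewrite sP.
Qed.

Lemma linear_kernel X M N (f : {linear M -> N}) (g : {linear X -> M}) :
  (forall x, f (g x) = 0) ->
  exists h : {linear X -> ker_module f}, forall x, val (h x) = g x.
Proof.
move=> fg; have gK x : g x \in in_ker f by rewrite inE fg.
have hl : linear (fun x => KerModule (gK x) : ker_module f).
  by move=> a x y; apply: val_inj; rewrite /= linearP.
by have [h hE] := linear_map hl; exists h => x; rewrite hE.
Qed.

Definition retract P M : Prop :=
  exists (i : {linear P -> M}) (r : {linear M -> P}), cancel i r.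

Lemma retract_iso M N : module_iso M N -> retract M N.
Proof. by move=> [f /linear_inverse[g [fK _]]]; exists f, g. Qed.

Lemma retract_trans N M P : retract M N -> retract N P -> retract M P.
Proof. by move=> [i [r ir]] [j [s js]]; exists (j \o i), (r \o s) => x /=; rewrite js ir. Qed.

Lemma retract_projective P M : retract P M -> projective M -> projective P.
Proof.
move=> [i [r ir]] Mp X Y f g fS; have [h hP] := Mp X Y f (g \o r) fS.
by exists (h \o i) => x; rewrite /= hP /= ir.
Qed.

Lemma retract_injective P M : retract P M -> injective_module M -> injective_module P.
Proof.
move=> [i [r ir]] Mi X Y f g fI; have [h hP] := Mi X Y f (i \o g) fI.
by exists (r \o h) => x; rewrite /= hP /= ir.
Qed.

Lemma retract_fin_gen P M : retract P M -> fin_gen M -> fin_gen P.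
Proof.
move=> [i [r ir]] [m [s sP]]; exists m, (r \o s) => x.
have [c ix] := sP (i x); exists c; rewrite -[LHS]ir ix linear_sum.
by apply: eq_bigr => j _; rewrite linearZ.
Qed.

Lemma retract_kernel P M (i : {linear P -> M}) (r : {linear M -> P}) :
  cancel i r -> module_iso (ker_module r * P)%type M.
Proof.
move=> ir; pose f (u : ker_module r * P) : M := val u.1 + i u.2.
have fl : linear f.
  by move=> a [u x] [v y]; rewrite /f /= !linearP scalerDr addrACA.
have [g gE] := linear_map fl; exists g; apply: linear_bijective => [[u x]|y].
  rewrite gE /f /= => e0.
  have x0 : x = 0.
    have := congr1 r e0; rewrite linearD ir linear0.
    by have /eqP-> := valP u; rewrite add0r.
  move: e0; rewrite x0 linear0 addr0 => u0.
  by congr pair; apply: val_inj; apply: u0.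
have yr : y - i (r y) \in in_ker r by rewrite inE linearB ir subrr.
by exists (KerModule yr, r y); rewrite gE /f /= subrK.
Qed.

Lemma summand_retract P M : retract P M <-> exists X : lmodType R, module_iso (X * P)%type M.
Proof.
split=> [[i [r ir]]|[X /retract_iso XP]].
  by exists (ker_module r); apply: retract_kernel ir.
apply: retract_trans XP.
have il : linear (fun x : P => (0 : X, x)).
  by move=> a x y; congr pair; rewrite /= scaler0 addr0.
have [i iE] := linear_map il.
by exists i, snd => x; rewrite iE.
Qed.

Lemma retract_projectionl M N : retract M (M * N)%type.
Proof.
have il : linear (fun x : M => (x, 0 : N)).
  by move=> a x y; congr pair; rewrite /= scaler0 addr0.
have [i iE] := linear_map il.
by exists i, fst => x; rewrite iE.
Qed.

Lemma fin_gen_iso M N : module_iso M N -> fin_gen M -> fin_gen N.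
Proof. by move=> MN; apply/retract_fin_gen/retract_iso/module_iso_sym. Qed.

Lemma prod_trivial_iso N P : (forall x : P, x = 0) -> module_iso (N * P)%type N.
Proof.
move=> P0; exists fst; apply: linear_bijective => [[x y] /= ->|x].
  by rewrite (P0 y).
by exists (x, 0).
Qed.
End LinearMaps.

(** * Cosyzygies and injective dimension *)

Section InjectiveDimension.
Variable R : pzRingType.
Implicit Types V W I J C Z : lmodType R.

Definition short_exact V J W (a : {linear V -> J}) (b : {linear J -> W}) : Prop :=
  [/\ injective a, onto b & forall x, b x = 0 <-> exists y, a y = x].

(** A relation rather than a function of V, because J may be any injective module
    containing V; the choice matters up to injective summands only
    ([cosyzygy_schanuel]). *)
Definition cosyzygy V W : Prop :=
  exists J, exists a : {linear V -> J}, exists b : {linear J -> W},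
    injective_module J /\ short_exact a b.

Lemma short_exact_split V J W (a : {linear V -> J}) (b : {linear J -> W}) :
  injective_module V -> short_exact a b ->
  exists s : {linear W -> J}, cancel s b.
Proof.
move=> Vi [aI bS ab]; have [r rE] := Vi V J a idfun aI.
have [|s sE] := @linear_factor _ _ _ _ b (idfun \- (a \o r)) bS.
  by move=> x /ab[y <-]; rewrite /= rE subrr.
exists s => w; have [x <-] := bS w; rewrite sE /= linearB.
by rewrite (_ : b (a (r x)) = 0) ?subr0 //; apply/ab; exists (r x).
Qed.

Lemma cosyzygy_injective V W :
  cosyzygy V W -> injective_module V -> injective_module W.
Proof.
move=> [J [a [b [Ji ab]]]] Vi; have [s sb] := short_exact_split Vi ab.
by apply: retract_injective Ji; exists s, b.
Qed.

Lemma cosyzygy_isol V V' W : module_iso V V' -> cosyzygy V W -> cosyzygy V' W.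
Proof.
move=> /module_iso_sym[f fb] [J [a [b [Ji [aI bS ab]]]]].
exists J, (a \o f), b; split=> //; split=> //.
  by apply: inj_comp => //; apply: bij_inj.
case: fb => g fK gK x; split=> [/ab[y <-]|[y <-]]; last by apply/ab; exists (f y).
by exists (g y); rewrite /= gK.
Qed.

Lemma injective_prod I J :
  injective_module I -> injective_module J -> injective_module (I * J)%type.
Proof.
move=> Ii Ji X Y f g fI.
have [h hE] := Ii X Y f (fst \o g) fI.
have [l lE] := Ji X Y f (snd \o g) fI.
have hl : linear (fun y => (h y, l y)) by move=> a x y; rewrite !linearP.
have [m mE] := linear_map hl; exists m => x.
by rewrite mE hE lE /=; case: (g x).
Qed.

(** The new injective factor of V is absorbed by the middle term, so that the
    cosyzygy stays the same; this lets Schanuel's lemma be iterated. *)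
Lemma cosyzygy_prodl V W J : injective_module J -> cosyzygy V W ->
  cosyzygy (V * J)%type W.
Proof.
move=> Ji [I [a [b [Ii [aI bS ab]]]]].
have al : linear (fun u : V * J => (a u.1, u.2)).
  by move=> c u v; rewrite /= linearP.
have [a' aE] := linear_map al.
exists (I * J)%type, a', (b \o fst); split; first exact: injective_prod.
split=> [[u x] [v y]|w|[x y]].
- by rewrite !aE /= => -[/aI-> ->].
- by have [x <-] := bS w; exists (x, 0).
split=> [/ab[v vx]|[[v z]]]; first by exists (v, y); rewrite aE /= vx.
by rewrite aE /= => -[<- _]; apply/ab; exists v.
Qed.

(** Schanuel's lemma for injectives.  Extend the two embeddings of V to
    f : J -> I and g : I -> J, inducing F : W -> Z on the cokernels; the
    endomorphism id - g f of J kills V and so factors as t after b.  The matrix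
    with entries F, b', t, - g is an isomorphism from W * I to Z * J. *)
Lemma cosyzygy_schanuel V J I W Z (a : {linear V -> J}) (b : {linear J -> W})
    (a' : {linear V -> I}) (b' : {linear I -> Z}) :
  injective_module J -> injective_module I ->
  short_exact a b -> short_exact a' b' -> module_iso (W * I)%type (Z * J)%type.
Proof.
move=> Ji Ii [aI bS ab] [aI' bS' ab'].
have ba y : b (a y) = 0 by apply/ab; exists y.
have ba' y : b' (a' y) = 0 by apply/ab'; exists y.
have [f fE] := Ii V J a a' aI; have [g gE] := Ji V I a' a aI'.
have [|F FE] := @linear_factor _ _ _ _ b (b' \o f) bS.
  by move=> x /ab[y <-]; rewrite /= fE ba'.
have [|t tE] := @linear_factor _ _ _ _ b (idfun \- (g \o f)) bS.
  by move=> x /ab[y <-]; rewrite /= fE gE subrr.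
have ul : linear (fun u : W * I => (F u.1 + b' u.2, t u.1 - g u.2)).
  move=> c u v; congr pair; rewrite /= (linearP F, linearP t).
    by rewrite linearP scalerDr addrACA.
  by rewrite (linearP g) scalerBr opprD addrACA.
have [u uE] := linear_map ul.
exists u; apply: linear_bijective => [[w i]|[z x]].
  rewrite uE /=; have [x <-] := bS w; rewrite FE tE /= -linearD => -[].
  move=> /ab'[v va] /eqP; rewrite -addrA -opprD -linearD -va gE subr_eq0.
  move=> /eqP xv; have bx : b x = 0 by rewrite xv ba.
  rewrite bx; congr pair; move: va; rewrite xv fE => /eqP.
  by rewrite -subr_eq0 opprD addNKr oppr_eq0 => /eqP.
have [y <-] := bS' z; exists (b (x + g y), y - f (x + g y)).
rewrite uE /= FE tE /= -linearD addrC subrK; congr pair.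
by rewrite linearB opprB addrA subrK addrK.
Qed.

Lemma injective0 J : (forall x : J, x = 0) -> injective_module J.
Proof.
by move=> J0 X Y f g fI; exists \0 => x; rewrite [RHS]J0 [LHS]J0.
Qed.

Lemma inj_dim_le0 V : inj_dim_le V 0 <-> injective_module V.
Proof.
split=> [[I [e [d [[Ii eI e0 _] I0]]]]|Vi].
  apply: retract_injective (Ii 0%N); apply: retract_iso; exists e.
  apply: linear_bijective => [x|y]; first by rewrite -(linear0 e) => /eI.
  by apply/e0; apply: (I0 1%N).
pose Z : lmodType R := ker_module (idfun : {linear V -> V}).
have Z0 (x : Z) : x = 0 by apply: val_inj; apply/eqP; apply: (valP x).
pose I i : lmodType R := if i is 0 then V else Z.
exists I, idfun, (fun i => \0); split; last by case=> [|i] // _ x; apply: Z0.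
split=> [[|i]|//|x|i x]; first exact: Vi.
- exact: injective0 Z0.
- by split=> // _; exists x.
by split=> // _; exists 0; rewrite [RHS]Z0.
Qed.

(** Splits off the first term of a resolution, or puts one in front: this
    makes the injective dimension accessible by induction on cosyzygies. *)
Lemma inj_dim_leS V n :
  inj_dim_le V n.+1 <-> exists2 W, cosyzygy V W & inj_dim_le W n.
Proof.
split=> [[I [e [d [[Ii eI e0 dE] I0]]]]|].
  pose W : lmodType R := ker_module (d 1%N).
  have [|b bE] := linear_kernel (f := d 1%N) (g := d 0%N).
    by move=> x; apply/dE; exists x.
  pose v : {linear W -> I 1%N} := val : {linear W -> I 1%N}.
  exists W.
    exists (I 0%N), e, b; split=> //; split=> // [w|x].
      have /dE[x xw] : d 1%N (val w) = 0 by apply/eqP; apply: (valP w).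
      by exists x; apply: val_inj; rewrite bE.
    rewrite -e0; split=> [/(congr1 val)|dx]; first by rewrite bE.
    by apply: val_inj; rewrite bE.
  exists (fun i => I i.+1), v, (fun i => d i.+1); split=> [|i ni]; last first.
    exact: (I0 i.+1).
  split=> // x.
  split=> [dx|[w <-]]; last by apply/eqP; apply: (valP w).
  have xK : x \in in_ker (d 1%N) by apply/eqP.
  by exists (KerModule xK).
move=> [W [J [a [b [Ji [aI bS ab]]]]] [I [e [d [[Ii eI e0 dE] I0]]]]].
pose I' i : lmodType R := if i is i'.+1 then I i' else J.
pose d' i : {linear I' i -> I' i.+1} :=
  if i is i'.+1 return {linear I' i -> I' i.+1} then d i' else e \o b.
exists I', a, d'; split; last by case=> [|i] //; apply: I0.
split=> // [[]//|x|[|i] x].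
- by rewrite -ab; split=> /= [|->]; rewrite ?linear0 // -(linear0 e) => /eI.
- rewrite e0; split=> [[w <-]|[y <-]]; last by exists (b y).
  by have [y <-] := bS w; exists y.
exact: dE.
Qed.

Lemma inj_dim_le_prod V J n :
  injective_module J -> inj_dim_le V n -> inj_dim_le (V * J)%type n.
Proof.
move=> Ji; case: n => [/inj_dim_le0 Vi|n /inj_dim_leS[W VW Wn]].
  by apply/inj_dim_le0; apply: injective_prod.
by apply/inj_dim_leS; exists W => //; apply: cosyzygy_prodl.
Qed.

Lemma inj_dim_le_iso V V' n : module_iso V V' -> inj_dim_le V n -> inj_dim_le V' n.
Proof.
move=> iVV'; case: n => [/inj_dim_le0 Vi|n /inj_dim_leS[W VW Wn]].
  apply/inj_dim_le0; apply: retract_injective Vi; apply: retract_iso.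
  exact: module_iso_sym.
by apply/inj_dim_leS; exists W => //; apply: cosyzygy_isol VW.
Qed.

(** The n-th cosyzygy is injective whichever injective modules are used to
    compute it.  The first cosyzygy of the given sequence and that of a short
    resolution agree up to injective factors, by Schanuel's lemma; the extra
    factor is carried along by replacing C 1 with C 1 * I. *)
Lemma inj_dim_le_cosyzygy (C : nat -> lmodType R) n :
  (forall i, cosyzygy (C i) (C i.+1)) -> inj_dim_le (C 0%N) n ->
  injective_module (C n).
Proof.
elim: n C => [|n IH] C CC; first by move=> /inj_dim_le0.
move=> /inj_dim_leS[W [I [a' [b' [Ii ab']]]] Wn].
have [J [a [b [Ji ab]]]] := CC 0%N.
have {}Wn : inj_dim_le (C 1%N * I)%type n.
  apply: inj_dim_le_iso (inj_dim_le_prod Ji Wn).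
  exact: cosyzygy_schanuel ab' ab.
case: n => [|n] in IH Wn *.
  by move/inj_dim_le0: Wn; apply: retract_injective; apply: retract_projectionl.
pose C' i : lmodType R := if i is i'.+1 then C i'.+2 else (C 1%N * I)%type.
apply: (IH C') => // -[|i]; last exact: CC.
exact: cosyzygy_prodl.
Qed.

Lemma cosyzygy_inj_dim_le (C : nat -> lmodType R) n :
  (forall i, cosyzygy (C i) (C i.+1)) -> injective_module (C n) ->
  inj_dim_le (C 0%N) n.
Proof.
elim: n C => [|n IH] C CC Cn; first exact/inj_dim_le0.
by apply/inj_dim_leS; exists (C 1%N) => //; apply: (IH (fun i => C i.+1)).
Qed.

End InjectiveDimension.

(** * Extension of linear maps between vector spaces *)

Section VectorSpaces.
Variables (k : fieldType) (X Y V : lmodType k).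
Variables (f : {linear X -> Y}) (g : {linear X -> V}).

(** Graphs of linear maps from a subspace of Y to V that extend g; the empty
    set is admitted as well, so that the empty chain has an upper bound. *)
Definition partial_extension (G : set (Y * V)) : Prop :=
  [/\ forall c u v, G u -> G v -> G (c *: u + v),
      forall u v, G u -> G v -> u.1 = v.1 -> u.2 = v.2 &
      forall u, G u -> forall x, G (f x, g x)].

Lemma partial_extension_chain (F : set (set (Y * V))) :
  (F `<=` partial_extension)%classic -> total_on F subset ->
  partial_extension (\bigcup_(G in F) G)%classic.
Proof.
move=> FP Ft.
have F2 u v : (\bigcup_(G in F) G)%classic u -> (\bigcup_(G in F) G)%classic v ->
    exists2 G, F G & G u /\ G v.
  move=> [G FG Gu] [H FH Hv]; have [GH|HG] := Ft G H FG FH.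
    by exists H => //; split=> //; apply: GH.
  by exists G => //; split=> //; apply: HG.
split=> [c u v Fu Fv|u v Fu Fv|u [G FG Gu] x].
- have [G FG [Gu Gv]] := F2 u v Fu Fv.
  by exists G => //; have [GL _ _] := FP G FG; apply: GL.
- have [G FG [Gu Gv]] := F2 u v Fu Fv.
  by have [_ GU _] := FP G FG; apply: GU.
by exists G => //; have [_ _ Gf] := FP G FG; apply: (Gf u).
Qed.

(** A partial extension that misses y extends to the subspace spanned by y as
    well, with value 0 at y. *)
Lemma partial_extension_step (G : set (Y * V)) (u0 : Y * V) (y : Y) :
  partial_extension G -> G u0 -> (forall u, G u -> u.1 != y) ->
  exists2 H, (G `<` H)%classic & partial_extension H.
Proof.
move=> [GL GU Gf] Gu0 yG.
have G0 : G 0 by rewrite -(addNr u0) -scaleN1r; apply: GL.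
have GZ c u : G u -> G (c *: u) by move=> Gu; rewrite -[c *: u]addr0; apply: GL.
pose H : set (Y * V) := fun u => exists c v, G v /\ u = c *: (y, 0) + v.
exists H.
  split=> [u Gu|HG]; first by exists 0, u; rewrite scale0r add0r.
  have /HG/yG : H (y, 0) by exists 1, 0; rewrite scale1r addr0.
  by rewrite eqxx.
split=> [c u v [a [u' [Gu ->]]] [b [v' [Gv ->]]]|u v|u [a [u' [Gu _]]] x].
- exists (c * a + b), (c *: u' + v'); split; first exact: GL.
  by rewrite scalerDr addrACA scalerA -scalerDl.
- move=> [a [u' [Gu ->]]] [b [v' [Gv ->]]] /= E.
  rewrite !scaler0 !add0r.
  have [ab|ab] := eqVneq a b.
    by apply: GU => //; move: E; rewrite ab => /addrI.
  have Gw : G ((a - b)^-1 *: (v' - u')).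
    by apply: GZ; rewrite addrC -scaleN1r; apply: GL.
  have := yG _ Gw; rewrite /= => /eqP[].
  have -> : v'.1 - u'.1 = (a - b) *: y.
    by rewrite scalerBl; apply/eqP; rewrite subr_eq addrAC E addrAC subrr add0r.
  by rewrite scalerA mulVf ?subr_eq0 // scale1r.
by exists 0, (f x, g x); split; [apply: Gf Gu _ | rewrite scale0r add0r].
Qed.

(** Vector spaces are injective, in any dimension: a partial extension that is
    maximal, by Zorn's lemma, is defined everywhere. *)
Lemma vector_space_extension :
  injective f -> exists h : {linear Y -> V}, forall x, h (f x) = g x.
Proof.
move=> fI; have [G [Ge Gmax]] := Zorn_bigcup partial_extension_chain.
have [GL GU Gf] := Ge.
have [u0 Gu0] : exists u, G u.
  apply/not_existsP => GN.
  pose H : set (Y * V) := fun u => exists x, u = (f x, g x).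
  apply: (Gmax H); last first.
    split=> [c _ _ [x ->] [y ->]|_ _ [x ->] [y ->] /= /fI->//|_ [x _] y].
      by exists (c *: x + y); rewrite !linearP.
    by exists y.
  split=> [u /GN//|HG]; apply: (GN (f 0, g 0)); apply: HG.
  by exists 0.
have /choice[h hG] : forall y, exists v, G (y, v).
  move=> y; apply/not_existsP => yG.
  have [|H GH He] := partial_extension_step (y := y) Ge Gu0.
    by move=> [z v] Gu; apply/eqP => /= zy; apply: (yG v); rewrite -zy.
  exact: Gmax GH He.
have hl : linear h.
  move=> c x y; have Gc := GL c _ _ (hG x) (hG y).
  by have := GU _ _ (hG (c *: x + y)) Gc erefl.
have [l lE] := linear_map hl; exists l => x; rewrite lE.
by have := GU _ _ (hG (f x)) (Gf _ Gu0 x) erefl.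
Qed.
End VectorSpaces.

(** * The left dual of a bimodule *)

Definition restriction (R S : pzRingType) (f : {rmorphism R -> S})
  (M : lmodType S) : Type := M.

Section Restriction.
Variables (R S : pzRingType) (f : {rmorphism R -> S}) (M : lmodType S).
Local Notation rM := (restriction f M).
HB.instance Definition _ := GRing.Zmodule.on rM.

Definition restriction_scale (a : R) (x : rM) : rM := f a *: (x : M).

Fact restriction_scaleA a b x :
  restriction_scale a (restriction_scale b x) = restriction_scale (a * b) x.
Proof. by rewrite /restriction_scale scalerA rmorphM. Qed.

Fact restriction_scale1 : left_id 1 restriction_scale.
Proof. by move=> x; rewrite /restriction_scale rmorph1 scale1r. Qed.

Fact restriction_scaleDr : right_distributive restriction_scale +%R.
Proof. by move=> a x y; apply: scalerDr. Qed.

Fact restriction_scaleDl x : {morph restriction_scale^~ x : a b / a + b}.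
Proof. by move=> a b; rewrite /restriction_scale rmorphD; apply: scalerDl. Qed.

HB.instance Definition _ := GRing.Zmodule_isLmodule.Build R rM
  restriction_scaleA restriction_scale1 restriction_scaleDr restriction_scaleDl.
End Restriction.

Section LeftDual.
Variables (k : fieldType) (A : falgType k).
Local Notation E := (enveloping A).
Implicit Types X Y M N P Q : lmodType E.

Definition lact (a : A) : E := tens a (1 : A^c).
Definition ract (a : A) : E := tens (1 : A) (a : A^c).

Fact lact_zmod_morphism : zmod_morphism lact.
Proof. by move=> a b; apply: (linearB (tensr (1 : A^c))). Qed.

Fact lact_monoid_morphism : monoid_morphism lact.
Proof. by split=> // a b; rewrite /lact [RHS]tensM mulr1. Qed.

HB.instance Definition _ := GRing.isZmodMorphism.Build A E lact lact_zmod_morphism.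
HB.instance Definition _ := GRing.isMonoidMorphism.Build A E lact lact_monoid_morphism.

Lemma ractM a b : ract (a * b) = ract b * ract a.
Proof. by rewrite /ract [RHS]tensM mulr1. Qed.

Fact ract_is_linear : linear ract.
Proof. exact: tens_is_linear_r. Qed.

HB.instance Definition _ := GRing.isLinear.Build k A E *:%R ract ract_is_linear.

Lemma lact_scale (c : k) a : lact (c *: a) = c *: lact a.
Proof. exact: (tensZl (B := A^c)). Qed.

Lemma ract1 : ract 1 = 1. Proof. by []. Qed.

Lemma lract_comm a b : lact a * ract b = ract b * lact a.
Proof. by rewrite [LHS]tensM [RHS]tensM !mul1r !mulr1. Qed.

Lemma tens_lract a (b : A) : tens a (b : A^c) = lact a * ract b.
Proof. by rewrite [RHS]tensM mulr1 mul1r. Qed.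

Definition left_module X : lmodType A := restriction lact X.

Section Dual.
Variable X : lmodType E.

Definition left_linear_form : {pred X -> A} :=
  [pred phi : X -> A |
    `[< forall a x y, phi (lact a *: x + y) = a * phi x + phi y >]].

Fact left_linear_form_zmod_closed : zmod_closed left_linear_form.
Proof.
split=> [|f g /asboolP fl /asboolP gl]; apply/asboolP => a x y.
  by rewrite mulr0 addr0.
by rewrite !fctE fl gl opprD addrACA mulrBr.
Qed.
HB.instance Definition _ := GRing.isZmodClosed.Build (X -> A)
  left_linear_form left_linear_form_zmod_closed.

(** The module Hom_A(X, A) of left linear maps.  It uses up the left action on X,
    and becomes a left A-module through the right action on X. *)
Inductive left_dual : Type :=
  LeftDual (phi : X -> A) of phi \in left_linear_form.

Definition left_dual_val (u : left_dual) : X -> A := let: LeftDual phi _ := u in phi.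
Coercion left_dual_val : left_dual >-> Funclass.

HB.instance Definition _ := [isSub for left_dual_val].
HB.instance Definition _ := [Choice of left_dual by <:].
HB.instance Definition _ := [SubChoice_isSubZmodule of left_dual by <:].

Lemma left_dual_eq (phi psi : left_dual) : (forall x, phi x = psi x) -> phi = psi.
Proof. by move=> E; apply/val_inj/funext. Qed.

Lemma left_dualP (phi : left_dual) a x y : phi (lact a *: x + y) = a * phi x + phi y.
Proof. by have /asboolP := valP phi; apply. Qed.

Fact left_dual_scale_subproof (a : A) (phi : left_dual) :
  (fun x => phi (ract a *: x)) \in left_linear_form.
Proof.
apply/asboolP => b x y.
by rewrite scalerDr scalerA -lract_comm -scalerA left_dualP.
Qed.

Definition left_dual_scale a phi := LeftDual (left_dual_scale_subproof a phi).

Fact left_dual_scaleA a b phi :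
  left_dual_scale a (left_dual_scale b phi) = left_dual_scale (a * b) phi.
Proof. by apply: left_dual_eq => x /=; rewrite scalerA ractM. Qed.

Fact left_dual_scale1 : left_id 1 left_dual_scale.
Proof. by move=> phi; apply: left_dual_eq => x /=; rewrite ract1 scale1r. Qed.

Lemma left_dualD phi psi x : (phi + psi : left_dual) x = phi x + psi x.
Proof. by []. Qed.

Lemma left_dual_add (phi : left_dual) x y : phi (x + y) = phi x + phi y.
Proof. by have := left_dualP phi 1 x y; rewrite rmorph1 scale1r mul1r. Qed.

Fact left_dual_scaleDr : right_distributive left_dual_scale +%R.
Proof. by move=> a phi psi; apply: left_dual_eq. Qed.

Fact left_dual_scaleDl phi : {morph left_dual_scale^~ phi : a b / a + b}.
Proof.
move=> a b; apply: left_dual_eq => x /=; rewrite linearD scalerDl.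
exact: left_dual_add.
Qed.

HB.instance Definition _ := GRing.Zmodule_isLmodule.Build A left_dual
  left_dual_scaleA left_dual_scale1 left_dual_scaleDr left_dual_scaleDl.

Lemma left_dualZ a (phi : left_dual) x : (a *: phi) x = phi (ract a *: x).
Proof. by []. Qed.

Lemma left_dual0 (phi : left_dual) : phi 0 = 0.
Proof. by apply: (addIr (phi 0)); rewrite -left_dual_add !add0r. Qed.

Lemma left_dual_lact (phi : left_dual) a x : phi (lact a *: x) = a * phi x.
Proof. by have := left_dualP phi a x 0; rewrite !addr0 left_dual0 addr0. Qed.

End Dual.

Lemma left_dual_map X Y (f : {linear X -> Y}) :
  exists g : {linear left_dual Y -> left_dual X}, forall phi x, g phi x = phi (f x).
Proof.
have fP (phi : left_dual Y) : (fun x => phi (f x)) \in @left_linear_form X.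
  by apply/asboolP => a x y; rewrite linearP left_dualP.
have gl : linear (fun phi => LeftDual (fP phi)).
  by move=> a phi psi; apply: left_dual_eq => x; rewrite [RHS]left_dualD left_dualZ /= linearZ.
by have [g gE] := linear_map gl; exists g => phi x; rewrite gE.
Qed.

Lemma left_dual_iso X Y : module_iso X Y -> module_iso (left_dual X) (left_dual Y).
Proof.
move=> [f /linear_inverse[g [fK gK]]].
have [f' fE] := left_dual_map f; have [g' gE] := left_dual_map g.
by exists g'; exists f' => phi; apply: left_dual_eq => x; rewrite ?(fE, gE) ?(fK, gK).
Qed.

Lemma left_dual_bimoduleE (phi : left_dual (bimodule A)) (x : A) :
  phi (x : bimodule A) = x * phi (1 : A).
Proof. by rewrite -left_dual_lact bimodule_scaleE !mulr1. Qed.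

(** A left linear form on the regular bimodule is right multiplication by its
    value at 1. *)
Lemma left_dual_bimodule : module_iso (left_dual (bimodule A)) (A^o).
Proof.
have fl : linear (fun phi : left_dual (bimodule A) => phi (1 : A) : A^o).
  move=> a phi psi; rewrite [LHS]left_dualD left_dualZ bimodule_scaleE !mul1r.
  by rewrite left_dual_bimoduleE.
have [f fE] := linear_map fl; exists f; apply: linear_bijective => [phi|v].
  rewrite fE => phi1; apply: left_dual_eq => x.
  by rewrite left_dual_bimoduleE phi1 mulr0.
have vP : (fun x : bimodule A => (x : A) * v) \in @left_linear_form (bimodule A).
  by apply/asboolP => a x y; rewrite bimodule_scaleE mulr1 mulrDl mulrA.
by exists (LeftDual vP); rewrite fE /= mul1r.
Qed.

End LeftDual.

(** * Coordinates in the enveloping algebra *)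

Lemma dual_basis (k : fieldType) (A : falgType k) (P : lmodType A) :
  fin_gen P -> projective P ->
  exists m (s : 'I_m -> P) (r : 'I_m -> {linear P -> A^o}),
    forall x, x = \sum_(j < m) (r j x : A) *: s j.
Proof.
move=> [m [s sP]] Pp.
have fS : onto (freemod_map s).
  move=> x; have [c ->] := sP x; exists [ffun i => c i].
  by apply: eq_bigr => i _; rewrite ffunE.
have [t tP] := Pp _ _ (freemod_map s) idfun fS.
have rl j : linear (fun x => t x j : A^o) by move=> a x y; rewrite linearP !ffunE.
have /choice[r rE] := fun j => linear_map (rl j).
by exists m, s, r => x; rewrite -[LHS]tP; apply: eq_bigr => j _; rewrite rE.
Qed.

Section LeftCoordinates.
Variables (k : fieldType) (A : falgType k).
Local Notation E := (enveloping A).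
Local Notation n := (\dim {:A}).
Local Notation e := (vbasis {:A}).
Implicit Types (a b : A) (t : E).

(** The coordinates of an element of the enveloping algebra over its left
    tensor factor, with respect to the basis of elements 1 ⊗ e_j. *)
Definition left_coord (j : 'I_n) (t : E) : A :=
  tlift (fun (a : A) (b : A^c) => coord e j (b : A) *: a) t.

Lemma left_coord_linear j : linear (left_coord j).
Proof. by apply: tlift_is_linear => a c b b'; rewrite linearP scalerDl scalerA. Qed.

Lemma left_coordD j t u : left_coord j (t + u) = left_coord j t + left_coord j u.
Proof. by have := left_coord_linear j 1 t u; rewrite !scale1r. Qed.

Lemma left_coord0 j : left_coord j 0 = 0.
Proof. by apply: (addIr (left_coord j 0)); rewrite -left_coordD !add0r. Qed.

Lemma left_coord_tens j a b : left_coord j (tens a (b : A^c)) = coord e j b *: a.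
Proof.
apply: (@tlift_tens _ _ _ _ (fun (a : A) (b : A^c) => coord e j (b : A) *: a)).
  by move=> {}b c x y; rewrite scalerDr !scalerA mulrC.
by move=> {}a c x y; rewrite linearP scalerDl scalerA.
Qed.

Lemma tensor_ind_lract (Q : E -> Prop) :
  Q 0 -> (forall t u, Q t -> Q u -> Q (t + u)) ->
  (forall a b, Q (lact a * ract b)) -> forall t, Q t.
Proof.
by move=> Q0 QD Qt t; elim/tensor_ind: t => // a b; have := Qt a b; rewrite -tens_lract.
Qed.

Lemma left_coord_lact j a t : left_coord j (lact a * t) = a * left_coord j t.
Proof.
elim/tensor_ind_lract: t => [|t u IHt IHu|a' b].
- by rewrite mulr0 left_coord0 mulr0.
- by rewrite mulrDr !left_coordD IHt IHu mulrDr.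
by rewrite mulrA -rmorphM -!tens_lract !left_coord_tens scalerAr.
Qed.

Lemma left_coord_decomp t : t = \sum_(j < n) lact (left_coord j t) * ract e`_j.
Proof.
elim/tensor_ind_lract: t => [|t u IHt IHu|a b].
- by rewrite big1 // => j _; rewrite left_coord0 rmorph0 mul0r.
- rewrite [in LHS]IHt [in LHS]IHu -big_split; apply: eq_bigr => j _.
  by rewrite left_coordD rmorphD mulrDl.
rewrite -tens_lract [in LHS](vbasis_decomp b).
rewrite (linear_sum (tens a : A^c -> tensor A A^c)); apply: eq_bigr => j _.
by rewrite left_coord_tens -tens_lract tensZl -tensZr.
Qed.

(** The matrix of right multiplication by a in the basis e also describes the
    action of 1 ⊗ a on left coordinates. *)
Lemma left_coord_ract j a t :
  left_coord j (ract a * t) = \sum_(i < n) coord e j (e`_i * a) *: left_coord i t.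
Proof.
elim/tensor_ind_lract: t => [|t u IHt IHu|a' b].
- by rewrite mulr0 left_coord0 big1 // => i _; rewrite left_coord0 scaler0.
- rewrite mulrDr left_coordD IHt IHu -big_split; apply: eq_bigr => i _ /=.
  by rewrite left_coordD scalerDr.
rewrite mulrA -lract_comm -mulrA -ractM -!tens_lract left_coord_tens.
under eq_bigr do rewrite left_coord_tens scalerA mulrC.
rewrite -scaler_suml; congr (_ *: _).
rewrite [in LHS](vbasis_decomp b) mulr_suml linear_sum.
by apply: eq_bigr => i _; rewrite -scalerAl linearZ.
Qed.
End LeftCoordinates.

(** * Left duals of projective bimodules and of covers *)

Section Coinduced.
Variables (k : fieldType) (A : falgType k).
Local Notation E := (enveloping A).
Implicit Types (a b : A) (t : E).

(** The left dual of the enveloping algebra is Hom_k(A, A), the module coinduced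
    from the vector space A: a k-linear map Y -> A amounts to an A-linear map
    from Y into it. *)
Lemma left_dual_coinduced (Y : lmodType A) (h : Y -> A) :
  (forall (c : k) x y, h (c%:A *: x + y) = c *: h x + h y) ->
  exists T : {linear Y -> left_dual (E^o : lmodType E)},
    forall y a b, T y (lact a * ract b) = a * h (b *: y).
Proof.
move=> hl; pose T0 y (a : A) (b : A^c) := a * h ((b : A) *: y).
have br y a : linear (T0 y a).
  move=> c b b'; rewrite /T0.
  have -> : (c *: b + b' : A) = c%:A * (b : A) + b' by rewrite mulr_algl.
  by rewrite scalerDl -scalerA hl mulrDr scalerAr.
have bl y b : linear (T0 y ^~ b) by move=> c a a'; rewrite /T0 mulrDl scalerAl.
have TD y : {morph tlift (T0 y) : t u / t + u}.
  by move=> t u; have := tlift_is_linear (br y) 1 t u; rewrite !scale1r.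
have Tt y a b : tlift (T0 y) (lact a * ract b) = a * h (b *: y).
  by rewrite -tens_lract; apply: (tlift_tens (bl y) (br y)).
have T00 y : tlift (T0 y) 0 = 0 by apply: (addIr (tlift (T0 y) 0)); rewrite -TD !add0r.
have Tl y : tlift (T0 y) \in @left_linear_form _ _ (E^o : lmodType E).
  apply/asboolP => a t u; rewrite TD; congr (_ + _).
  elim/tensor_ind_lract: t => [|t t' IH IH'|a' b].
  - by rewrite scaler0 T00 mulr0.
  - by rewrite scalerDr !TD IH IH' mulrDr.
  by rewrite [_ *: _]mulrA -rmorphM !Tt mulrA.
have ll : linear (fun y => LeftDual (Tl y)).
  move=> c x y; apply: left_dual_eq => t.
  rewrite [RHS]left_dualD left_dualZ /=.
  elim/tensor_ind_lract: t => [|t t' IH IH'|a b].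
  - by rewrite scaler0 !T00 addr0.
  - by rewrite scalerDr !TD IH IH' addrACA.
  have -> : ract c *: (lact a * ract b : E^o) = lact a * ract (b * c).
    by rewrite [LHS]mulrA -lract_comm -mulrA -ractM.
  rewrite !Tt -mulrDr; congr (_ * _).
  by rewrite scalerDr scalerA; have := hl 1 ((b * c) *: x) (b *: y); rewrite !scale1r.
by have [T TE] := linear_map ll; exists T => y a b; rewrite TE /=.
Qed.

Lemma ract_scalar (c : k) : ract c%:A = lact c%:A :> E.
Proof. by rewrite linearZ lact_scale. Qed.

(** Coinduction turns an extension problem for A-modules into one for vector
    spaces. *)
Lemma left_dual_regular_injective : injective_module (left_dual (E^o : lmodType E)).
Proof.
move=> X Y f g fI.
pose rX : lmodType k := restriction (in_alg A) X.
pose rY : lmodType k := restriction (in_alg A) Y.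
have rfl : linear (fun x : rX => f (x : X) : rY) by move=> c x y; apply: linearP.
have [rf rfE] := linear_map rfl.
have g1l : linear (fun x : rX => g (x : X) (1 : E)).
  move=> c x y; rewrite -[c *: x]/(c%:A *: (x : X)) (linearP g) [LHS]left_dualD.
  rewrite left_dualZ ract_scalar.
  by rewrite left_dual_lact mulr_algl.
have [g1 g1E] := linear_map g1l.
have [|h hE] := @vector_space_extension k rX rY A rf g1.
  by move=> x y; rewrite !rfE; apply: fI.
have [T TE] := left_dual_coinduced (fun c => linearP h c).
exists T => x; apply: left_dual_eq => t.
elim/tensor_ind_lract: t => [|t u IHt IHu|a b].
- by rewrite !left_dual0.
- by rewrite !left_dual_add IHt IHu.
rewrite TE left_dual_lact; congr (_ * _).
have := hE (b *: x); rewrite rfE g1E linearZ => ->.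
by rewrite linearZ left_dualZ; congr (g x _); apply: mulr1.
Qed.

(** By a dual basis, the left dual of P is a direct summand of a power of the
    left dual of the enveloping algebra. *)
Lemma left_dual_projective_injective (P : lmodType E) :
  fin_gen P -> projective P -> injective_module (left_dual P).
Proof.
move=> Pf Pp; have [m [s [r rP]]] := dual_basis Pf Pp.
have il j : linear (fun t : (E^o : lmodType E) => (t : E) *: s j).
  by move=> a x y; rewrite scalerDl scalerA.
have /choice[i iE] := fun j => linear_map (il j).
have /choice[i' iE'] := fun j => left_dual_map (i j).
have /choice[r' rE'] := fun j => left_dual_map (r j).
move=> X Y f g fI.
have /choice[h hE] := fun j => left_dual_regular_injective (i' j \o g) fI.
have Hl : linear (fun y => \sum_(j < m) r' j (h j y)).
  move=> a x y; rewrite scaler_sumr -big_split; apply: eq_bigr => j _.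
  by rewrite !linearP.
have [H HE] := linear_map Hl; exists H => x; apply: left_dual_eq => z.
rewrite HE [in RHS](rP z).
have evD (phi : left_dual P) : {morph phi : u v / u + v} by apply: left_dual_add.
rewrite (big_morph _ (evD (g x)) (left_dual0 (g x))).
rewrite (big_morph (fun phi : left_dual P => phi z) (fun _ _ => erefl) erefl).
by apply: eq_bigr => j _; rewrite rE' hE /= iE' iE.
Qed.

(** The enveloping algebra is free as a left A-module on the elements
    1 ⊗ e_j. *)
Lemma left_projective (P : lmodType E) :
  fin_gen P -> projective P -> projective (left_module P).
Proof.
move=> Pf Pp X Y f g fS; have [m [s [r rP]]] := dual_basis Pf Pp.
have /choice[x xE] : forall ij : 'I_m * 'I_(\dim {:A}), exists x,
    f x = g (ract (vbasis {:A})`_ij.2 *: s ij.1) by move=> ij; apply: fS.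
have hl : linear (fun z : left_module P =>
    \sum_(i < m) \sum_(j < \dim {:A}) left_coord j (r i (z : P)) *: x (i, j)).
  move=> a y z; rewrite scaler_sumr -big_split; apply: eq_bigr => i _.
  rewrite scaler_sumr -big_split; apply: eq_bigr => j _ /=.
  rewrite -[a *: y]/(lact a *: (y : P)) linearP left_coordD left_coord_lact.
  by rewrite scalerDl scalerA.
have [h hE] := linear_map hl; exists h => z; rewrite hE linear_sum.
rewrite [in RHS](rP z) linear_sum; apply: eq_bigr => i _.
rewrite [in RHS](left_coord_decomp (r i z)) scaler_suml !linear_sum.
apply: eq_bigr => j _; rewrite linearZ xE /= -scalerA.
exact/esym/(linearZ_LR g).
Qed.

Lemma left_projective_bimodule : projective (left_module (bimodule A)).
Proof.
move=> X Y f g fS; have [x xE] := fS (g (1 : A)).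
have hl : linear (fun a : left_module (bimodule A) => (a : A) *: x).
  move=> a y z; rewrite -[a *: y]/(lact a *: (y : bimodule A)).
  by rewrite bimodule_scaleE mulr1 scalerDl scalerA.
have [h hE] := linear_map hl; exists h => a; rewrite hE linearZ xE -linearZ.
by congr (g _); rewrite [LHS]bimodule_scaleE !mulr1.
Qed.

Section Cover.
Variables (M P : lmodType E) (f : {linear P -> M}).
Hypothesis (fS : onto f) (Mp : projective (left_module M)).

Lemma left_splitting : exists p : {linear left_module P -> left_module (ker_module f)},
  forall u : ker_module f, p (val u) = u.
Proof.
have fl : linear (fun x : left_module P => f (x : P) : left_module M).
  by move=> a x y; apply: linearP.
have [lf lfE] := linear_map fl.
have [|s sE] := @Mp _ _ lf idfun.
  by move=> y; have [x <-] := fS y; exists x; rewrite lfE.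
have fs x : f (s x) = x by have := sE x; rewrite lfE.
have pin x : (x : P) - s (f x) \in in_ker f by rewrite inE linearB fs subrr.
have pl : linear (fun x : left_module P => KerModule (pin x) : left_module (ker_module f)).
  move=> a x y; apply: val_inj => /=.
  have -> : f (a *: x + y : left_module P) = a *: (f x : left_module M) + f y.
    exact: fl.
  by rewrite linearP scalerBr opprD addrACA.
have [p pE] := linear_map pl; exists p => u; rewrite pE; apply: val_inj => /=.
by have /eqP -> := valP u; rewrite linear0 subr0.
Qed.

Lemma left_projective_kernel : projective (left_module P) ->
  projective (left_module (ker_module f)).
Proof.
apply: retract_projective; have [p pE] := left_splitting.
have vl : linear (fun u : left_module (ker_module f) => val (u : ker_module f) : left_module P).
  by move=> a x y.
have [v vE] := linear_map vl.
by exists v, p => u; rewrite vE pE.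
Qed.

(** Dualizing is exact on the sequence ker f -> P -> M because the latter splits
    over A on the left. *)
Lemma left_dual_exact :
  exists (a : {linear left_dual M -> left_dual P})
         (b : {linear left_dual P -> left_dual (ker_module f)}),
  short_exact a b /\ forall phi u, b phi u = phi (val u).
Proof.
pose v : {linear ker_module f -> P} := val : {linear ker_module f -> P}.
have [a aE] := left_dual_map f; have [b bE] := left_dual_map v.
exists a, b; split; last exact: bE.
have [p pE] := left_splitting.
split=> [phi psi E|phi|phi].
- apply: left_dual_eq => x; have [y <-] := fS x.
  by rewrite -!aE E.
- have psiP : (fun x => phi (p x)) \in @left_linear_form _ _ P.
    apply/asboolP => c x y; rewrite -[lact c *: x]/(c *: (x : left_module P)).
    by rewrite (linearP p); apply: left_dualP.
  by exists (LeftDual psiP); apply: left_dual_eq => u; rewrite bE /= pE.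
split=> [phi0|[psi <-]]; last first.
  by apply: left_dual_eq => u; rewrite bE aE; have /eqP -> := valP u; rewrite left_dual0.
have phiK x : f x = 0 -> phi x = 0.
  move=> /eqP fx; have xK : x \in in_ker f by [].
  by have := bE phi (KerModule xK); rewrite phi0.
have /choice[s sE] := fS.
have phis x : phi (s (f x)) = phi x.
  apply/eqP; rewrite -subr_eq0; apply/eqP.
  have := left_dual_add phi (s (f x) - x) x; rewrite subrK => ->.
  by rewrite addrK phiK // linearB sE subrr.
have psiP : (fun y => phi (s y)) \in @left_linear_form _ _ M.
  apply/asboolP => c x y; rewrite -left_dualP -[RHS]phis.
  by congr (phi (s _)); rewrite linearP !sE.
by exists (LeftDual psiP); apply: left_dual_eq => x; rewrite aE /= phis.
Qed.
End Cover.
End Coinduced.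

(** * Extension of bimodule maps from syzygies *)

(** For projective P and surjective f this is the vanishing of Ext^1(M, Q). *)
Definition kernel_extension (R : pzRingType) (M P Q : lmodType R)
    (f : {linear P -> M}) : Prop :=
  forall u : {linear ker_module f -> Q},
    exists v : {linear P -> Q}, forall x, v (val x) = u x.

Section Extension.
Variables (k : fieldType) (A : falgType k).
Local Notation E := (enveloping A).
Local Notation n := (\dim {:A}).
Local Notation e := (vbasis {:A}).
Variables (M P : lmodType E) (f : {linear P -> M}).
Hypothesis (fS : onto f) (Mp : projective (left_module M)).
Hypothesis (Mi : injective_module (left_dual M)).

(** The left coordinates u_j of u are left linear forms on the kernel.  A linear
    section s of the restriction of forms, which exists because left_dual M is
    injective, extends them to forms on P, and these are the coordinates of the
    extension of u.  They assemble to a map that commutes with the right action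
    too: the latter acts on the u_j through a matrix over k, and s commutes with
    that matrix. *)
Lemma kernel_extension_regular : kernel_extension (E^o : lmodType E) f.
Proof.
move=> u; have [a [b [ab bE]]] := left_dual_exact fS Mp.
have [s sb] := short_exact_split Mi ab.
have uP j : (fun x => left_coord j (u x)) \in @left_linear_form _ _ (ker_module f).
  by apply/asboolP => c x y; rewrite linearP left_coordD left_coord_lact.
pose u_ j := LeftDual (uP j).
have u_ract j c : c *: u_ j = \sum_(i < n) (coord e j (e`_i * c))%:A *: u_ i.
  apply: left_dual_eq => x; rewrite left_dualZ /= linearZ left_coord_ract.
  rewrite (big_morph (fun phi : left_dual _ => phi x) (fun _ _ => erefl) erefl).
  apply: eq_bigr => i _.
  by rewrite left_dualZ ract_scalar left_dual_lact mulr_algl.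
pose v x : E := \sum_(j < n) lact (s (u_ j) x) * ract e`_j.
have vD x y : v (x + y) = v x + v y.
  rewrite /v -big_split; apply: eq_bigr => j _.
  by rewrite left_dual_add rmorphD mulrDl.
have v0 : v 0 = 0 by apply: (addIr (v 0)); rewrite -vD !add0r.
have vlact c x : v (lact c *: x) = lact c * v x.
  rewrite /v mulr_sumr; apply: eq_bigr => j _.
  by rewrite left_dual_lact rmorphM mulrA.
have vract c x : v (ract c *: x) = ract c * v x.
  transitivity (\sum_(j < n) \sum_(i < n)
      coord e j (e`_i * c) *: (lact (s (u_ i) x) * ract e`_j)).
    apply: eq_bigr => j _; rewrite -left_dualZ -linearZ u_ract linear_sum.
    rewrite (big_morph (fun phi : left_dual _ => phi x) (fun _ _ => erefl) erefl).
    rewrite rmorph_sum mulr_suml; apply: eq_bigr => i _.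
    rewrite (linearZ_LR s) left_dualZ ract_scalar left_dual_lact mulr_algl.
    rewrite -[X in X * _]/(lact _).
    by rewrite lact_scale scalerAl.
  rewrite exchange_big mulr_sumr; apply: eq_bigr => i _.
  rewrite mulrA -lract_comm -mulrA -ractM [in RHS](vbasis_decomp (e`_i * c)).
  rewrite linear_sum mulr_sumr; apply: eq_bigr => j _.
  by rewrite linearZ scalerAr.
have vl : linear (v : P -> (E^o : lmodType E)).
  move=> t x y; rewrite vD; congr (_ + _).
  elim/tensor_ind_lract: t => [|t t' IH IH'|c d]; first by rewrite !scale0r v0.
    by rewrite !scalerDl vD IH IH'.
  by rewrite -[in LHS]scalerA vlact vract -scalerA.
have [w wE] := linear_map vl; exists w => x; rewrite wE [RHS]left_coord_decomp.
apply: eq_bigr => j _; congr (lact _ * _).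
by rewrite -bE sb.
Qed.

Lemma kernel_extension_projective (Q : lmodType E) :
  fin_gen Q -> projective Q -> kernel_extension Q f.
Proof.
move=> Qf Qp u; have [m [s [r rP]]] := dual_basis Qf Qp.
have /choice[v vE] := fun j => kernel_extension_regular (r j \o u).
have wl : linear (fun x => \sum_(j < m) (v j x : E) *: s j).
  move=> a x y; rewrite scaler_sumr -big_split; apply: eq_bigr => j _ /=.
  by rewrite linearP scalerDl scalerA.
have [w wE] := linear_map wl; exists w => x; rewrite wE [RHS]rP.
by apply: eq_bigr => j _; rewrite vE.
Qed.
End Extension.

(** * The Fitting lemma *)

Section Fitting.
Variables (k : fieldType) (A : falgType k) (M : lmodType A).
Variables (h : {linear M -> M}).

Lemma kspanS n : kspan M n -> kspan M n.+1.
Proof.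
move=> [s sS]; exists (fun i => if unlift ord0 i is Some j then s j else 0) => x.
have [v <-] := sS x; exists (\row_i if unlift ord0 i is Some j then v 0 j else 0).
rewrite /kcomb big_ord_recl unlift_none scaler0 add0r.
by apply: eq_bigr => i _; rewrite mxE liftK.
Qed.

(** Polynomials in h are polynomials in any matrix that represents h on
    generators over k. *)
Lemma poly_end_matrix n (s : 'I_n.+1 -> M) (H : 'M[k]_n.+1) p v :
  (forall v, h (kcomb s v) = kcomb s (v *m H)) ->
  poly_end h p (kcomb s v) = kcomb s (v *m horner_mx H p).
Proof.
move=> hH; have itE j : iter j h (kcomb s v) = kcomb s (v *m H ^+ j).
  by elim: j => [|j IH]; rewrite ?mulmx1 //= IH hH exprSr mulmxA.
have -> : horner_mx H p = \sum_(j < size p) p`_j *: H ^+ j.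
  rewrite -[in LHS](coefK p) poly_def rmorph_sum; apply: eq_bigr => j _.
  by rewrite /= horner_mxZ rmorphXn /= horner_mx_X.
rewrite mulmx_sumr; under [LHS]eq_bigr do rewrite itE.
elim/big_rec2: _ => [|j y z _ ->].
  by rewrite /kcomb big1 // => i _; rewrite mxE !scale0r.
by rewrite -kcomb_is_additive scalemxAr.
Qed.

Lemma poly_end_fixed p x : h x = x -> poly_end h p x = p.[1]%:A *: x.
Proof.
move=> hx; rewrite horner_coef !scaler_suml; apply: eq_bigr => j _.
by rewrite expr1n mulr1; congr (_ *: _); elim: (j : nat) => //= i ->.
Qed.

(** The map h w is the projection of the Fitting decomposition of h: the
    identity on the part where h is invertible, with inverse w there, and zero
    on the part where h is nilpotent. *)
Lemma fitting : fin_gen M -> exists w : {linear M -> M},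
  [/\ forall x, w (h x) = h (w x),
      forall x, h (w (h (w x))) = h (w x) &
      forall x, h x = x -> w x = x].
Proof.
move=> /fin_gen_kspan[n /kspanS[s sS]].
have [H hH] := exists_matrix h sS.
have peE p v := poly_end_matrix p v hH.
have hE v : h (kcomb s v) = kcomb s (v *m horner_mx H 'X) by rewrite horner_mx_X hH.
have HM r t : horner_mx H r *m horner_mx H t = horner_mx H (r * t).
  by rewrite rmorphM.
(* Separate the zero eigenvalue: q * 'X^m annihilates H and q is prime to 'X. *)
have [m [q q0 chE]] := multiplicity_XsubC (char_poly H) 0.
have {}q0 : ~~ root q 0.
  by apply: (implyP q0); apply: monic_neq0; apply: char_poly_monic.
rewrite subr0 in chE.
have : coprimep q ('X^(m.+1)).
  by apply: coprimep_expr; rewrite -['X]subr0 coprimep_XsubC.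
case/Bezout_eq1_coprimepP => -[u v] /= uv1.
pose p := v * 'X^m.
have [w wE] := linear_map (pe_linear h p).
exists w; split=> x.
- have [y <-] := sS x; rewrite !wE hE !peE hE -!mulmxA.
  by rewrite !HM mulrC.
- have [y <-] := sS x.
  rewrite !(wE, peE, hE) -!mulmxA; congr (kcomb s (_ *m _)).
  rewrite !HM; apply/eqP; rewrite -subr_eq0 -rmorphB.
  have -> : p * ('X * (p * 'X)) - p * 'X = - (u * v * 'X) * char_poly H.
    have vX : v * 'X^(m.+1) = 1 - u * q by rewrite -uv1 addrC addKr.
    have pX : p * 'X = v * 'X^(m.+1) by rewrite exprSr mulrA.
    rewrite [X in X - _]mulrA pX -[X in _ - X]mul1r -mulrBl {1}vX addrAC subrr.
    by rewrite add0r chE exprSr; ring.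
  by rewrite rmorphM /= Cayley_Hamilton mulr0.
rewrite wE => hx; rewrite poly_end_fixed // hornerM hornerXn expr1n mulr1.
have := congr1 (fun r : {poly k} => r.[1]) uv1.
rewrite !(hornerE, hornerXn) expr1n mulr1.
have [/eqP x0|x0 uv1'] := boolP (x == 0); first by rewrite x0 scaler0.
suff q1 : q.[1] = 0 by move: uv1'; rewrite q1 mulr0 add0r => ->; rewrite !scale1r.
apply/eqP/negPn/negP => q1; case/negP: x0; apply/eqP.
have : poly_end h (char_poly H) x = 0.
  have [y <-] := sS x; rewrite peE Cayley_Hamilton mulmx0 /kcomb big1 // => i _.
  by rewrite mxE !scale0r.
rewrite poly_end_fixed // chE hornerM hornerXn expr1n mulr1 => qx.
rewrite -[x]scale1r -(scale1r (1 : A)) -(mulVf q1) -scalerA -mulr_algl -scalerA.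
by rewrite qx scaler0.
Qed.
End Fitting.

(** * Modules with isomorphic syzygies *)

Definition projective_free (R : pzRingType) (N : lmodType R) : Prop :=
  forall P : lmodType R, projective_summand P N -> forall x : P, x = 0.

Lemma projective_free_retract (R : pzRingType) (N P : lmodType R) :
  projective_free N -> projective P -> retract P N -> forall x : P, x = 0.
Proof. by move=> Nf Pp /summand_retract NP; apply: Nf. Qed.

Lemma projective_summandr (R : pzRingType) (N P Q : lmodType R) :
  projective P -> module_iso (N * P)%type Q -> projective_summand P Q.
Proof. by move=> Pp NPQ; split=> //; exists N. Qed.

Section Kernels.
Variables (k : fieldType) (A : falgType k).
Implicit Types M N P Q S : lmodType A.

(** A projective summand Q of the kernel would split off P: the projection onto
    Q extends to P.  The complement of Q in P still maps onto M, against
    minimality of the cover, unless Q is zero. *)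
Lemma kernel_projective_free M P (f : {linear P -> M}) :
  fin_gen P -> essential_epi f ->
  (forall Q, fin_gen Q -> projective Q -> kernel_extension Q f) ->
  projective_free (ker_module f).
Proof.
move=> Pf [fS fE] ext Q [Qp /summand_retract QK] y.
have Qf := retract_fin_gen QK (ker_fin_gen f Pf).
have [i [r ir]] := QK; have [v vE] := ext Q Qf Qp r.
pose vf : {linear ker_module f -> P} := val : {linear ker_module f -> P}.
pose e : {linear P -> P} := idfun \- (vf \o i \o v).
have [|x ex] := fE P e _ (val (i y)).
  move=> m; have [x <-] := fS m; exists x; rewrite /= linearB.
  by have /eqP-> := valP (i (v x)); rewrite subr0.
have := congr1 v ex; rewrite /= linearB !vE !ir subrr => /esym; apply.
Qed.

(** Extend the isomorphism phi of kernels and its inverse to F : P -> Q and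
    G : Q -> P.  The nilpotent Fitting part of F G is a summand of Q; since F G
    is the identity on the kernel of g, it is also a summand of N, so it
    vanishes and F G is invertible.  Then Q and N are summands of P and M, both
    with complement ker F, which meets the kernel of f trivially. *)
Lemma iso_of_kernels M N P Q (f : {linear P -> M}) (g : {linear Q -> N}) :
  fin_gen P -> projective P -> onto f -> kernel_extension Q f ->
  fin_gen Q -> projective Q -> onto g -> kernel_extension P g ->
  projective_free N -> module_iso (ker_module f) (ker_module g) ->
  exists S, [/\ fin_gen S, projective S & module_iso (N * S)%type M].
Proof.
move=> Pf Pp fS fext Qf Qp gS gext Nf [phi /linear_inverse[psi [phiK psiK]]].
pose vf : {linear ker_module f -> P} := val : {linear ker_module f -> P}.
pose vg : {linear ker_module g -> Q} := val : {linear ker_module g -> Q}.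
have [F FE] := fext (vg \o phi); have [G GE] := gext (vf \o psi).
have FG (u : ker_module g) : F (G (val u)) = val u by rewrite GE FE /= psiK.
have [w [_ wI wfix]] := fitting (F \o G) Qf.
have {}wI x : F (G (w (F (G (w x))))) = F (G (w x)) := wI x.
(* The image S of id - F G w is a projective summand of N. *)
have FGw x : F (G (w x)) = x.
  pose S := ker_module (F \o G \o w).
  have [|c cE] := linear_kernel (f := F \o G \o w) (g := idfun \- (F \o G \o w)).
    by move=> y; rewrite /= !linearB /= wI subrr.
  pose vS : {linear S -> Q} := val : {linear S -> Q}.
  have cv : cancel vS c.
    move=> y; apply: val_inj; rewrite cE /=.
    by have /eqP /= -> := valP y; rewrite subr0.
  have Sp : projective S by apply: retract_projective Qp; exists vS, c.
  have [|r rE] := linear_factor (g := c) gS.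
    move=> y /eqP gy; have yK : y \in in_ker g by [].
    have Fy : F (G y) = y by apply: (FG (KerModule yK)).
    by apply: val_inj; rewrite cE /= wfix // Fy subrr.
  have SN : retract S N by exists (g \o vS), r => y; rewrite /= rE cv.
  have := projective_free_retract Nf Sp SN (c x).
  by move/(congr1 val)/eqP; rewrite cE subr_eq0 => /eqP.
have [|F' FE'] := linear_factor (g := g \o F) fS.
  move=> x /eqP fx; have xK : x \in in_ker f by [].
  have /= -> : F x = val (phi (KerModule xK)) by apply: (FE (KerModule xK)).
  by apply/eqP; apply: (valP (phi _)).
have Gker x : g x = 0 -> f (G (w x)) = 0.
  move=> /eqP gx; have xK : x \in in_ker g by [].
  have Fx : F (G x) = x by apply: (FG (KerModule xK)).
  have Gx : G x = val (psi (KerModule xK)) by apply: (GE (KerModule xK)).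
  by rewrite wfix // Gx; apply/eqP; apply: (valP (psi _)).
have [|G' GE'] := linear_factor (g := f \o G \o w) gS; first exact: Gker.
have FG' y : F' (G' y) = y.
  by have [x <-] := gS y; rewrite GE' /= FE' /= FGw.
pose S := ker_module F.
have [|c cE] := linear_kernel (f := F) (g := idfun \- (G \o w \o F)).
  by move=> x; rewrite /= linearB FGw subrr.
pose vS : {linear S -> P} := val : {linear S -> P}.
have SP : retract S P.
  exists vS, c => y; apply: val_inj; rewrite cE /=.
  by have /eqP /= -> := valP y; rewrite !linear0 addr0.
exists S; split; [exact: retract_fin_gen Pf | exact: retract_projective Pp |].
have il : linear (fun u : N * S => G' u.1 + f (vS u.2)).
  by move=> a [x y] [z t]; rewrite /= !linearP scalerDr addrACA.
have [i iE] := linear_map il.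
exists i; apply: linear_bijective => [[x y]|m].
  rewrite iE /= => E0.
  have F0 : F (val y) = 0 by apply/eqP; apply: (valP y).
  have x0 : x = 0.
    by have := congr1 F' E0; rewrite linearD FG' FE' /= F0 !linear0 addr0.
  move: E0; rewrite x0 linear0 add0r => /eqP fy; congr pair.
  have yK : val y \in in_ker f by [].
  have := FE (KerModule yK); rewrite /= F0 => /esym phi0.
  have {}phi0 : phi (KerModule yK) = 0 by apply: val_inj.
  have := phiK (KerModule yK); rewrite phi0 linear0 => /(congr1 val) /= /esym y0.
  exact: val_inj.
have [x <-] := fS m; exists (F' (f x), c x).
by rewrite iE /= [ker_val _]cE /= linearB FE' /= GE' /= addrC subrK.
Qed.
End Kernels.

(** * Periods of syzygies *)

Section Periods.
Variables (k : fieldType) (A : falgType k).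
Implicit Types M N P Q : lmodType A.

Lemma syzygy_iso M N :
  fin_gen M -> module_iso M N -> module_iso (syzygy M) (syzygy N).
Proof.
move=> Mf MN; have [f /linear_inverse[g [fK gK]]] := MN.
have [Pp [cS cE]] := chosen_coverP Mf; set c := over_map _ in cS cE.
have fcC : projective_cover (f \o c).
  split=> //; split=> [y|X h fch].
    by have [x cx] := cS (g y); exists x; rewrite /= cx gK.
  apply: cE => y; have [x fx] := fch (f y); exists x.
  exact: (can_inj fK).
apply: module_iso_trans (syzygyP (fin_gen_iso MN Mf) fcC).
pose v : {linear ker_module c -> _} := val : {linear ker_module c -> _}.
have [|h hE] := linear_kernel (f := f \o c) (g := v).
  by move=> u; have /eqP /= -> := valP u; rewrite linear0.
exists h; apply: linear_bijective => [u /(congr1 val)|u].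
  by rewrite hE => u0; apply: val_inj.
have uK : val u \in in_ker c.
  by rewrite inE -(can_eq fK) linear0; apply: (valP u).
by exists (KerModule uK); apply: val_inj; rewrite hE.
Qed.

Lemma syz_iso n M N : fin_gen M -> module_iso M N -> module_iso (syz n M) (syz n N).
Proof.
move=> Mf MN; elim: n => // n IH.
exact: (syzygy_iso (syz_fin_gen n Mf)).
Qed.

Lemma syz_syz m n M : syz m (syz n M) = syz (m + n) M.
Proof. by rewrite /syz iterD. Qed.

Lemma syz_period M n p i : fin_gen M -> module_iso (syz (p + n) M) (syz n M) ->
  (n <= i)%N -> module_iso (syz (p + i) M) (syz i M).
Proof.
move=> Mf per /subnK<-; rewrite addnCA -(syz_syz _ n) -(syz_syz _ (p + n)).
by apply: syz_iso => //; apply: syz_fin_gen.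
Qed.

Lemma syz_period_mul M n p m : fin_gen M -> module_iso (syz (p + n) M) (syz n M) ->
  module_iso (syz (m * p + n) M) (syz n M).
Proof.
move=> Mf per; elim: m => [|m IH]; first exact: module_iso_refl.
rewrite mulSn -addnA; apply: module_iso_trans IH.
by apply: syz_period per _; rewrite ?leq_addl.
Qed.

Section Descent.
Variables (M : lmodType A) (d : nat).
Hypothesis Mf : fin_gen M.
Hypothesis ext : forall i Q, (d <= i)%N -> fin_gen Q -> projective Q ->
  kernel_extension Q (over_map (chosen_cover (syz i M))).

Lemma syz_projective_free i : (d < i)%N -> projective_free (syz i M).
Proof.
case: i => // i di; have cP := chosen_coverP (syz_fin_gen i Mf).
apply: kernel_projective_free (cP.2) _; last by move=> Q; apply: ext.
exact: cover_fin_gen cP.2 (syz_fin_gen i Mf).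
Qed.

Lemma syz_iso_descent i j : (d <= i)%N -> (d < j)%N ->
  module_iso (syz i.+1 M) (syz j.+1 M) ->
  exists P, [/\ fin_gen P, projective P & module_iso (syz j M * P)%type (syz i M)].
Proof.
move=> di dj ij.
have ci := chosen_coverP (syz_fin_gen i Mf).
have cj := chosen_coverP (syz_fin_gen j Mf).
have Pi := cover_fin_gen ci.2 (syz_fin_gen i Mf).
have Pj := cover_fin_gen cj.2 (syz_fin_gen j Mf).
apply: (iso_of_kernels Pi ci.1 ci.2.1 _ Pj cj.1 cj.2.1) ij.
- exact: ext Pj cj.1.
- exact: ext (ltnW dj) Pi ci.1.
exact: syz_projective_free.
Qed.

(** Descent from n to i: in each degree above d the projective complement is a
    summand of a syzygy without such summands. *)
Lemma syz_period_descent n p i : (0 < p)%N ->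
  module_iso (syz (p + n) M) (syz n M) -> (d < i)%N ->
  module_iso (syz (p + i) M) (syz i M).
Proof.
move=> p0 per di; have [ni|/ltnW] := leqP n i; first exact: syz_period per ni.
move=> /subnK; move: (n - i)%N => m; elim: m => [|m IH] in n per *.
  by rewrite add0n => ->.
rewrite addSn => mn; apply: (IH (m + i)%N) => //.
have dm : (d < m + i)%N by apply: leq_trans di (leq_addl _ _).
have [|||P [Pf Pp PE]] := @syz_iso_descent (m + i)%N (p + (m + i))%N.
- exact: ltnW.
- exact: leq_trans dm (leq_addl _ _).
- by apply: module_iso_sym; rewrite -addnS mn.
apply: (module_iso_trans _ PE); apply: module_iso_sym; apply: prod_trivial_iso.
exact: (syz_projective_free dm (projective_summandr Pp PE)).
Qed.

Lemma syz_period_stable n p : (0 < p)%N -> (d <= n)%N ->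
  module_iso (syz (p + n) M) (syz n M) ->
  exists P, [/\ fin_gen P, projective P & module_iso (syz (d + p) M * P)%type (syz d M)].
Proof.
move=> p0 dn per; apply: syz_iso_descent => //.
  by rewrite -[X in (X < _)%N]addn0 ltn_add2l.
by apply: module_iso_sym; rewrite addnC -addnS; apply: syz_period_descent per _.
Qed.
End Descent.
End Periods.

(** * Syzygies of the regular bimodule *)

Section EnvelopingSyzygies.
Variables (k : fieldType) (L : falgType k).
Local Notation X i := (syz i (bimodule L : lmodType (enveloping L))).
Local Notation c i := (over_map (chosen_cover (X i))).

Lemma syz_bimodule_fin_gen i : fin_gen (X i).
Proof. exact: syz_fin_gen (bimodule_fin_gen L). Qed.

Lemma syz_bimodule_cover i :
  [/\ projective_cover (c i), fin_gen (over_module (chosen_cover (X i))) & onto (c i)].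
Proof.
have cP := chosen_coverP (syz_bimodule_fin_gen i); split=> //; last exact: cP.2.1.
exact: cover_fin_gen cP.2 (syz_bimodule_fin_gen i).
Qed.

Lemma syz_bimodule_left_projective i : projective (left_module (X i)).
Proof.
elim: i => [|i IH]; first exact: left_projective_bimodule.
have [[cp _] cf cS] := syz_bimodule_cover i.
by apply: left_projective_kernel cS IH _; apply: left_projective.
Qed.

(** Hence the left duals of the syzygies are the successive cosyzygies of
    left_dual (bimodule L), which is L. *)
Lemma syz_left_dual_cosyzygy i : cosyzygy (left_dual (X i)) (left_dual (X i.+1)).
Proof.
have [[cp _] cf cS] := syz_bimodule_cover i.
have [a [b [ab _]]] := left_dual_exact cS (@syz_bimodule_left_projective i).
by exists (left_dual (over_module (chosen_cover (X i)))), a, b; split=> //;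
  apply: left_dual_projective_injective.
Qed.

Lemma inj_dim_syz_left_dual n :
  inj_dim_le (L^o : lmodType L) n <-> injective_module (left_dual (X n)).
Proof.
split=> [Ln|Xn].
  apply: (inj_dim_le_cosyzygy syz_left_dual_cosyzygy).
  by apply: inj_dim_le_iso Ln; apply/module_iso_sym/left_dual_bimodule.
apply: inj_dim_le_iso (left_dual_bimodule L) _.
exact: (cosyzygy_inj_dim_le syz_left_dual_cosyzygy Xn).
Qed.

Lemma syz_left_dual_injective d i : inj_dim_le (L^o : lmodType L) d ->
  (d <= i)%N -> injective_module (left_dual (X i)).
Proof.
move=> /inj_dim_syz_left_dual Xd /subnK<-; elim: (i - d)%N => // m IH.
exact: cosyzygy_injective (syz_left_dual_cosyzygy _) IH.
Qed.
End EnvelopingSyzygies.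

Theorem theorem4p4 (k : fieldType) (L : falgType k) (n p d : nat)
    (hper : eventually_periodic_algebra L n p) (hgor : gorenstein L d) :
  [/\ (d <= n <= d.+1)%N,
      exists P : lmodType (enveloping L),
        [/\ fin_gen P, projective P &
            module_iso (syz (d + p)%N (bimodule L : lmodType (enveloping L)) * P)%type
                       (syz d (bimodule L : lmodType (enveloping L)))] &
      n = d <->
      (forall P : lmodType (enveloping L),
         projective_summand P (syz d (bimodule L : lmodType (enveloping L))) ->
         forall x : P, x = 0)].
Proof.
have [[p0 + _] nmin] := hper; rewrite syz_syz => per.
have [[Ld dmin] _] := hgor.
have Lf := bimodule_fin_gen L.
(* The n-th syzygy recurs in degree d * p + n, which is at least d as 0 < p. *)
have dn : (d <= n)%N.
  apply: dmin; apply/inj_dim_syz_left_dual.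
  apply: retract_injective (syz_left_dual_injective (i := d * p + n) Ld _).
    apply/retract_iso/left_dual_iso/module_iso_sym.
    exact: syz_period_mul Lf per.
  by rewrite (leq_trans (leq_pmulr d p0)) ?leq_addr.
have ext i Q : (d <= i)%N -> fin_gen Q -> projective Q ->
    kernel_extension Q (over_map (chosen_cover (syz i (bimodule L : lmodType (enveloping L))))).
  move=> di; apply: kernel_extension_projective.
  - by have [] := syz_bimodule_cover L i.
  - exact: syz_bimodule_left_projective.
  exact: syz_left_dual_injective di.
have [P [Pf Pp PE]] := syz_period_stable Lf ext p0 dn per.
have minimal i : module_iso (syz (p + i) (bimodule L : lmodType (enveloping L)))
    (syz i (bimodule L : lmodType (enveloping L))) -> (n <= i)%N.
  by move=> pi; apply: nmin; exists p; rewrite ?syz_syz.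
split.
- rewrite dn /=; apply: minimal; exact: (syz_period_descent Lf ext p0 per).
- by exists P.
split=> [nd Q|Xd].
  have := syz_projective_free Lf ext (i := p + n).
  rewrite nd -[X in (X < _)%N]add0n ltn_add2r => /(_ p0) pf [Qp].
  move=> /summand_retract QX; apply: (projective_free_retract pf Qp).
  apply: retract_trans QX (retract_iso _); apply: module_iso_sym.
  by rewrite -nd.
apply/eqP; rewrite eqn_leq dn andbT; apply: minimal; rewrite addnC.
apply: (module_iso_trans _ PE); apply: module_iso_sym; apply: prod_trivial_iso.
exact: (Xd P (projective_summandr Pp PE)).
Qed.
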